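(* Let $f_{\min}>-\infty$ and assume $K$ is closed at $\infty$. If the LICQC, SCC and SOSC hold at every minimizer of (P), including every minimizer at infinity, then there exists an integer $k_0>0$ such that $$x_0^{2\ell}\big(\tilde f-(f_{\min}-\epsilon)\,x_0^d\big)\in\mathrm{Ideal}[\tilde c_{\mathcal E}]+\mathrm{QM}[\tilde c_{\mathcal I}]$$ for every $\epsilon>0$ and for all $\ell\ge k_0$.
   Context: **Problem.** $\mathcal E,\mathcal I$ are disjoint finite label sets; $f,c_i\ (i\in\mathcal E\cup\mathcal I)$ are real polynomials in $x=(x_1,\dots,x_n)$; $d=\deg f$. Problem (P): minimize $f(x)$ subject to $c_i(x)=0\ (i\in\mathcal E)$, $c_j(x)\ge 0\ (j\in\mathcal I)$. $K$ is its feasible set and $f_{\min}=\inf_K f$. ''Minimizer'' means global minimizer. **Homogenization.** $\tilde x=(x_0,x)\in\mathbb R^{n+1}$; $\tilde p(\tilde x)=x_0^{\deg p}p(x/x_0)$. Let $\widetilde K^h=\{\tilde x:\tilde c_i(\tilde x)=0\,(i\in\mathcal E),\ \tilde c_j(\tilde x)\ge0\,(j\in\mathcal I),\ x_0\ge0\}$, $\widetilde K^c=\widetilde K^h\cap\{x_0>0\}$, $\widetilde K=\widetilde K^h\cap\{\|\tilde x\|^2=1\}$. $K$ (with its given description) is closed at $\infty$ if the closure of $\widetilde K^c$ equals $\widetilde K^h$. Homogenized problem (H): minimize $F(\tilde x)=\tilde f(\tilde x)-f_{\min}x_0^d$ subject to $\tilde c_i(\tilde x)=0\ (i\in\mathcal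 E)$, $\|\tilde x\|^2-1=0$, $\tilde c_j(\tilde x)\ge0\ (j\in\mathcal I)$, $x_0\ge0$. A point $x^*\in\mathbb R^n$ is a minimizer at infinity of (P) if $(0,x^* )\in\widetilde K$ and $F(0,x^* )=0$. **Optimality conditions.** For a problem $\min\phi(u)$ s.t. $h_i(u)=0\ (i\in E)$, $h_j(u)\ge0\ (j\in I)$ and a local minimizer $u^*$, let $J(u^* )=\{i\in E\cup I: h_i(u^* )=0\}$. LICQC: the gradients $\nabla h_i(u^* )$, $i\in J(u^* )$, are linearly independent. Under LICQC there are unique multipliers $\lambda_i$ with $\nabla\phi(u^* )=\sum_{i\in E\cup I}\lambda_i\nabla h_i(u^* )$, $\lambda_j\ge0$ and $\lambda_jh_j(u^* )=0$ for $j\in I$. SCC: $\lambda_j+h_j(u^* )>0$ for all $j\in I$. SOSC: $v^T\nabla^2\mathscr L(u^* )v>0$ for all $v\ne0$ orthogonal to all $\nabla h_i(u^* )$, $i\in J(u^* )$, where $\mathscr L=\phi-\sum_i\lambda_ih_i$. These conditions are said to hold at a minimizer at infinity $x^*$ of (P) if they hold for problem (H) at $(0,x^* )$. **Algebra.** $\tilde c_{\mathcal E}=\{\tilde c_i\}_{i\in\mathcal E}\cup\{\|\tilde x\|^2-1\}$, $\tilde c_{\mathcal I}=\{\tilde c_j\}_{j\in\mathcal I}\cup\{x_0\}$. $\mathrm{Ideal}[h]$ is the ideal of $\mathbb R[\tilde x]$ generated by $h$; $\mathrm{QM}[g]=\Sigma[\tilde x]+\sum_jg_j\Sigma[\tilde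 x]$ with $\Sigma[\tilde x]$ the set of sums of squares of polynomials. *)

(* Defs.v *)
From HB Require Import structures.
From mathcomp Require Import all_boot all_order all_algebra.
From mathcomp Require Import all_classical all_reals all_analysis.
(* The notations of mpoly are incompatible with those of mathcomp-analysis. *)
From mathcomp Require Import -(notations) mpoly.

Set Implicit Arguments.
Unset Strict Implicit.
Unset Printing Implicit Defensive.

Import Order.TTheory GRing.Theory Num.Theory.
Import numFieldNormedType.Exports.

Local Open Scope classical_set_scope.
Local Open Scope ring_scope.

(* Points are row vectors [u : 'rV[R]_n]; coordinate [i] of [u] is [u 0 i]. *)
Definition peval (R : realType) (n : nat) (p : mpoly n R) (u : 'rV[R]_n) : R :=
  meval (u 0) p.

Definition pvar (R : realType) (n : nat) (i : 'I_n) : mpoly n R :=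
  mpolyX R (mnm1 i).

(* [msize p] is the degree plus one if [p != 0], and [0] if [p = 0]; the zero
   polynomial thus gets degree [0] (its homogenization is [0] anyway). *)
Definition pdeg (R : realType) (n : nat) (p : mpoly n R) : nat :=
  (mmeasure mdeg p).-1.

Definition grad (R : realType) (n : nat) (p : mpoly n R) (u : 'rV[R]_n) :
    'rV[R]_n :=
  \row_i peval (mderiv i p) u.

Definition hessian (R : realType) (n : nat) (p : mpoly n R) (u : 'rV[R]_n) :
    'M[R]_n :=
  \matrix_(i, j) peval (mderiv j (mderiv i p)) u.

Definition dotv (R : realType) (n : nat) (u v : 'rV[R]_n) : R :=
  \sum_i u 0 i * v 0 i.

(* Minimize [obj] subject to [eqc i = 0] for [i : E] and [0 <= ineqc j] for
   [j : I].  The labels of all the constraints form the disjoint sum [E + I]. *)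
Record pop (R : realType) (n : nat) (E I : finType) := Pop {
  obj : mpoly n R;
  eqc : E -> mpoly n R;
  ineqc : I -> mpoly n R }.

Definition constr (R : realType) (n : nat) (E I : finType) (P : pop R n E I)
    (k : E + I) : mpoly n R :=
  match k with inl i => eqc P i | inr j => ineqc P j end.

Definition feasible (R : realType) (n : nat) (E I : finType)
    (P : pop R n E I) : set 'rV[R]_n :=
  [set u | (forall i, peval (eqc P i) u = 0) /\
           (forall j, 0 <= peval (ineqc P j) u)].

Definition optimal_value (R : realType) (n : nat) (E I : finType)
    (P : pop R n E I) : \bar R :=
  ereal_inf [set (peval (obj P) u)%:E | u in feasible P].

Definition minimizer (R : realType) (n : nat) (E I : finType)
    (P : pop R n E I) (u : 'rV[R]_n) : Prop :=
  feasible P u /\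
  forall v, feasible P v -> peval (obj P) u <= peval (obj P) v.

Definition active (R : realType) (n : nat) (E I : finType) (P : pop R n E I)
    (u : 'rV[R]_n) : pred (E + I)%type :=
  [pred k | peval (constr P k) u == 0].

(* [free] is applied to the family of gradients indexed by the active labels:
   a gradient repeated under two labels makes the family dependent. *)
Definition LICQC (R : realType) (n : nat) (E I : finType) (P : pop R n E I)
    (u : 'rV[R]_n) : Prop :=
  free [seq grad (constr P k) u | k in active P u].

Definition lagrange_multiplier (R : realType) (n : nat) (E I : finType)
    (P : pop R n E I) (u : 'rV[R]_n) (lam : E + I -> R) : Prop :=
  grad (obj P) u = \sum_k lam k *: grad (constr P k) u /\
  forall j : I, 0 <= lam (inr j) /\ lam (inr j) * peval (ineqc P j) u = 0.

(* At a local minimizer satisfying [LICQC] there is exactly one Lagrange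
   multiplier; SCC and SOSC are conditions on this multiplier. *)
Definition SCC (R : realType) (n : nat) (E I : finType) (P : pop R n E I)
    (u : 'rV[R]_n) : Prop :=
  forall lam, lagrange_multiplier P u lam ->
  forall j : I, 0 < lam (inr j) + peval (ineqc P j) u.

Definition lagrangian (R : realType) (n : nat) (E I : finType)
    (P : pop R n E I) (lam : E + I -> R) : mpoly n R :=
  obj P - \sum_k lam k *: constr P k.

Definition SOSC (R : realType) (n : nat) (E I : finType) (P : pop R n E I)
    (u : 'rV[R]_n) : Prop :=
  forall lam, lagrange_multiplier P u lam ->
  forall v : 'rV[R]_n, v != 0 ->
    (forall k, k \in active P u -> dotv (grad (constr P k) u) v = 0) ->
    0 < (v *m hessian (lagrangian P lam) u *m v^T) 0 0.

Definition optimality_conditions (R : realType) (n : nat) (E I : finType)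
    (P : pop R n E I) (u : 'rV[R]_n) : Prop :=
  [/\ LICQC P u, SCC P u & SOSC P u].

(* In [n.+1] variables, the homogenizing variable has index [ord0], and the
   original variable of index [i] becomes that of index [lift ord0 i]. *)
Definition homogenize (R : realType) (n : nat) (p : mpoly n R) :
    mpoly n.+1 R :=
  \sum_(m <- msupp p)
    mcoeff m p *: (pvar R ord0 ^+ (pdeg p - mdeg m) *
                   \prod_(i < n) pvar R (lift ord0 i) ^+ m i).

Definition hpoint (R : realType) (n : nat) (x0 : R) (x : 'rV[R]_n) :
    'rV[R]_n.+1 :=
  \row_i (if unlift ord0 i is Some j then x 0 j else x0).

Lemma homogenizeE (R : realType) (n : nat) (p : mpoly n R) (x0 : R)
    (x : 'rV[R]_n) : x0 != 0 ->
  peval (homogenize p) (hpoint x0 x) = x0 ^+ pdeg p * peval p (x0^-1 *: x).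
Proof.
move=> x0N0; have e0 : hpoint x0 x 0 ord0 = x0 by rewrite mxE unlift_none.
have eS i : hpoint x0 x 0 (lift ord0 i) = x 0 i by rewrite mxE liftK.
rewrite /peval /homogenize raddf_sum /= mevalE mulr_sumr.
rewrite big_seq [RHS]big_seq; apply: eq_bigr => m mp.
rewrite mevalZ mevalM rmorphXn /= /pvar mevalXU e0 [RHS]mulrCA; congr (_ * _).
rewrite rmorph_prod /= (eq_bigr (fun i => x 0 i ^+ m i)); last first.
  by move=> i _; rewrite rmorphXn /= mevalXU eS.
rewrite [in RHS](eq_bigr (fun i => x0^-1 ^+ m i * x 0 i ^+ m i)); last first.
  by move=> i _; rewrite mxE exprMn.
rewrite big_split /= mulrA; congr (_ * _).
have mle : (mdeg m <= pdeg p)%N.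
  by rewrite /pdeg -ltnS (leq_trans (msize_mdeg_lt mp)) // leqSpred.
rewrite prodrXr -mdegE -{2}(subnK mle) exprD -mulrA -exprMn divff //.
by rewrite expr1n mulr1.
Qed.

Definition homog_cone (R : realType) (n : nat) (E I : finType)
    (P : pop R n E I) : set 'rV[R]_n.+1 :=
  [set u | [/\ forall i, peval (homogenize (eqc P i)) u = 0,
               forall j, 0 <= peval (homogenize (ineqc P j)) u
             & 0 <= u 0 ord0]].

Definition closed_at_infty (R : realType) (n : nat) (E I : finType)
    (P : pop R n E I) : Prop :=
  closure (homog_cone P `&` [set u : 'rV[R]_n.+1 | 0 < u 0 ord0]) =
  homog_cone P.

(* [None] labels the sphere equation and the inequality [0 <= x_0]. *)
Definition homogenized (R : realType) (n : nat) (E I : finType)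
    (P : pop R n E I) (fmin : R) : pop R n.+1 (option E) (option I) :=
  {| obj := homogenize (obj P) - fmin *: pvar R ord0 ^+ pdeg (obj P);
     eqc := fun k => if k is Some i then homogenize (eqc P i)
                     else \sum_(i < n.+1) pvar R i ^+ 2 - 1;
     ineqc := fun k => if k is Some j then homogenize (ineqc P j)
                       else pvar R ord0 |}.

Definition minimizer_at_infty (R : realType) (n : nat) (E I : finType)
    (P : pop R n E I) (fmin : R) (x : 'rV[R]_n) : Prop :=
  feasible (homogenized P fmin) (hpoint 0 x) /\
  peval (obj (homogenized P fmin)) (hpoint 0 x) = 0.

Definition ideal_gen (R : realType) (n : nat) (E : finType)
    (h : E -> mpoly n R) : set (mpoly n R) :=
  [set p | exists q : E -> mpoly n R, p = \sum_i h i * q i].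

Definition sos (R : realType) (n : nat) : set (mpoly n R) :=
  [set p | exists s : seq (mpoly n R), p = \sum_(q <- s) q ^+ 2].

Definition quadratic_module (R : realType) (n : nat) (I : finType)
    (g : I -> mpoly n R) : set (mpoly n R) :=
  [set p | exists s0, exists s : I -> mpoly n R,
     [/\ sos s0, forall j, sos (s j) & p = s0 + \sum_j g j * s j]].

(* Main.v *)
(* Put G = F + eps x_0^d, so that the polynomial in question is
   (x_0^l)^2 G; it is enough to show that G lies in M = Ideal + QM.  As K is
   closed at infinity, F and hence G are nonnegative on the compact set defined
   by the constraints of (H), and G vanishes there exactly at the minimizers at
   infinity.  At such a point z a penalty argument provides a Lagrange multiplier,
   and the second order conditions make z isolated, so there are finitely many.
   A polynomial partition of unity sum s^2 beta = 1, each s vanishing at all zeros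
   but one, reduces the claim to polynomials with at most one zero z.  For these,
   subtracting lambda_j (1 - kappa g_j)^(2N) g_j for the active inequalities,
   |x - z|^4 (1 - kappa g_j)^(2N) g_j for the inactive ones and suitable multiples
   of the equations leaves (x - z)^T P_N(x) (x - z) on the sphere.  The quadratic
   form of P_N increases with N on the cube, hence by Dini's argument is positive
   definite there for some N.  Expanding P_N in Bernstein polynomials then shows
   that the remainder is a sum of squares modulo the sphere. *)
Require Import Defs.
From HB Require Import structures.
From mathcomp Require Import all_boot all_order all_algebra.
From mathcomp Require Import all_classical all_reals all_analysis.
From mathcomp Require Import -(notations) mpoly.
From mathcomp Require Import ring lra.

Set Implicit Arguments.
Unset Strict Implicit.
Unset Printing Implicit Defensive.

Import Order.TTheory GRing.Theory Num.Theory.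
Import numFieldNormedType.Exports.

Local Open Scope classical_set_scope.
Local Open Scope ring_scope.

(** * Values and Taylor expansions of polynomials *)

(** The obstacle is that G may vanish, so that no uniform margin is available where the certificate
    must be found. Writing the remainder as (x - z)^T P_N(x) (x - z) and replacing the outer factors
    by a free unit vector v restores strictness. At x = z only the second order conditions are at
    stake; at x <> z every v not parallel to x - z is penalized, and the parallel one returns the
    value of G itself, corrected by the weights.

    The weights (1 - kappa g)^(2N) g have three virtues. The even power is a square, so they lie in
    QM. They tend to 0 where g >= 0 and to minus infinity where g < 0, so subtracting them repairs
    infeasible points at no cost, in the limit, at feasible ones. And for |kappa g| <= 1/2 they
    decrease with N whatever the sign of g, as Dini's argument requires.

    Bernstein expansions need positivity on the whole cube and not only on the sphere, so the square
    of the sphere equation is used as one more penalty. *)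

Section PolynomialCalculus.
Variables (R : realType) (n : nat).
Implicit Types (p q : mpoly n R) (u z : 'rV[R]_n).

Lemma pevalD p q u : peval (p + q) u = peval p u + peval q u.
Proof. exact: mevalD. Qed.

Lemma pevalB p q u : peval (p - q) u = peval p u - peval q u.
Proof. exact: mevalB. Qed.

Lemma pevalN p u : peval (- p) u = - peval p u.
Proof. exact: mevalN. Qed.

Lemma pevalM p q u : peval (p * q) u = peval p u * peval q u.
Proof. exact: mevalM. Qed.

Lemma pevalXn p k u : peval (p ^+ k) u = peval p u ^+ k.
Proof. exact: rmorphXn. Qed.

Lemma pevalZ (c : R) p u : peval (c *: p) u = c * peval p u.
Proof. exact: mevalZ. Qed.

Lemma pevalC (c : R) u : peval (mpolyC n c) u = c.
Proof. exact: mevalC. Qed.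

Lemma peval0 u : peval 0 u = 0.
Proof. exact: meval0. Qed.

Lemma peval1 u : peval 1 u = 1.
Proof. exact: meval1. Qed.

Lemma pevalX (i : 'I_n) u : peval (pvar R i) u = u 0 i.
Proof. exact: mevalXU. Qed.

Lemma peval_sum (T : Type) (r : seq T) (Q : pred T) (F : T -> mpoly n R) u :
  peval (\sum_(i <- r | Q i) F i) u = \sum_(i <- r | Q i) peval (F i) u.
Proof. exact: raddf_sum. Qed.

Lemma peval_prod (T : Type) (r : seq T) (Q : pred T) (F : T -> mpoly n R) u :
  peval (\prod_(i <- r | Q i) F i) u = \prod_(i <- r | Q i) peval (F i) u.
Proof. exact: rmorph_prod. Qed.

Definition pevalE := (pevalD, pevalB, pevalN, pevalM, pevalXn, pevalZ, pevalC,
  peval0, peval1, pevalX, peval_sum, peval_prod).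

Lemma mpoly_ringind (Q : mpoly n R -> Prop) :
  (forall c, Q (mpolyC n c)) -> (forall i, Q (pvar R i)) ->
  (forall p q, Q p -> Q q -> Q (p + q)) ->
  (forall p q, Q p -> Q q -> Q (p * q)) -> forall p, Q p.
Proof.
move=> QC QX QD QM; elim/mpolyind => [|c m p _ _ Qp]; first by rewrite -mpolyC0.
apply: (QD) => //; rewrite -mul_mpolyC; apply: (QM) => //.
rewrite mpolyXE_id; apply: (big_ind Q) => [||i _] //; first by rewrite -mpolyC1.
elim: (m i) => [|k IH]; first by rewrite expr0 -mpolyC1.
by rewrite exprS; apply: (QM) => //; exact: QX.
Qed.

Lemma continuous_peval p : continuous (fun u => peval p u : R).
Proof.
elim/mpoly_ringind: p => [c|i|p q Cp Cq|p q Cp Cq] u.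
- rewrite (_ : (fun v => _) = cst c); first exact: cst_continuous.
  by apply/funext => v; rewrite pevalC.
- rewrite (_ : (fun v => _) = (fun v : 'rV[R]_n => v 0 i)); first exact: coord_continuous.
  by apply/funext => v; rewrite pevalX.
- rewrite (_ : (fun v => _) = (fun v => peval p v) \+ (fun v => peval q v)).
    exact: continuousD (Cp u) (Cq u).
  by apply/funext => v; rewrite pevalD.
- rewrite (_ : (fun v => _) = (fun v => peval p v) \* (fun v => peval q v)).
    exact: continuousM (Cp u) (Cq u).
  by apply/funext => v; rewrite pevalM.
Qed.

Definition centered z (a : 'I_n) : mpoly n R := pvar R a - mpolyC n (z 0 a).

Lemma peval_centered z a u : peval (centered z a) u = u 0 a - z 0 a.
Proof. by rewrite !pevalE. Qed.

Lemma mderiv_centered z a b : mderiv b (centered z a) = (a == b)%:R.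
Proof.
rewrite mderivB mderivC subr0 mderivX mnm1E; case: eqP => [->|_] /=.
  rewrite scale1r -[RHS]mpolyX0; congr (mpolyX R _).
    by apply/mnmP => i; rewrite mnmBE mnm0E subnn.
by rewrite scale0r.
Qed.

(** By the product rule p q - p(z) q(z) = (p - p(z)) q + p(z) (q - q(z)). The cofactors are in
    general not unique; their values at [z] are, being the partial derivatives of [p] there. *)
Lemma hadamard z p : exists l : 'I_n -> mpoly n R,
  p = mpolyC n (peval p z) + \sum_a l a * centered z a.
Proof.
elim/mpoly_ringind: p => [c|i|p q [lp ep] [lq eq]|p q [lp ep] [lq eq]].
- exists (fun=> 0); rewrite pevalC big1 ?addr0 // => a _; exact: mul0r.
- exists (fun a => (a == i)%:R); rewrite pevalX (bigD1 i) //= eqxx mul1r.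
  rewrite big1 => [|a /negbTE ->]; last by rewrite mul0r.
  by rewrite addr0 addrC subrK.
- exists (fun a => lp a + lq a); rewrite pevalD mpolyCD {1}ep {1}eq.
  rewrite addrACA -big_split; congr (_ + _); apply: eq_bigr => a _.
  by rewrite mulrDl.
- exists (fun a => lp a * q + mpolyC n (peval p z) * lq a).
  rewrite pevalM mpolyCM {1}ep mulrDl {1}eq mulrDr -addrA; congr (_ + _).
  rewrite addrC mulr_suml mulr_sumr -big_split; apply: eq_bigr => a _ /=.
  by rewrite mulrDl mulrA mulrAC.
Qed.

Lemma grad_hadamard z p c (l : 'I_n -> mpoly n R) :
  p = mpolyC n c + \sum_a l a * centered z a ->
  forall a, peval (l a) z = grad p z 0 a.
Proof.
move=> -> a; rewrite mxE mderivD mderivC add0r raddf_sum peval_sum /=.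
rewrite (bigD1 a) //= big1 => [|b /negbTE nba]; rewrite mderivM mderiv_centered.
  rewrite eqxx mulr1 addr0 pevalD pevalM peval_centered subrr mulr0.
  by rewrite add0r.
by rewrite nba mulr0 addr0 pevalM peval_centered subrr mulr0.
Qed.

(** The ring is abstract because the same identities serve for polynomial entries and, after
    evaluation at a point, for real ones. *)
Definition qform (A : comNzRingType) r (P : 'I_r -> 'I_r -> A) (v : 'I_r -> A) :=
  \sum_a \sum_b P a b * (v a * v b).

Lemma peval_qform r (P : 'I_r -> 'I_r -> mpoly n R) (f : 'I_r -> mpoly n R) u :
  peval (qform P f) u =
  qform (fun a b => peval (P a b) u) (fun a => peval (f a) u).
Proof.
rewrite peval_sum; apply: eq_bigr => a _; rewrite peval_sum.
by apply: eq_bigr => b _; rewrite !pevalM.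
Qed.

Lemma taylor2 z p : exists P : 'I_n -> 'I_n -> mpoly n R,
  [/\ p = mpolyC n (peval p z)
          + \sum_a mpolyC n (grad p z 0 a) * centered z a
          + qform P (centered z),
      forall a b, P a b = P b a
    & forall a b, 2 * peval (P a b) z = hessian p z a b].
Proof.
have [l pE] := hadamard z p.
have lz := grad_hadamard pE.
have [m mE] : exists m : 'I_n -> 'I_n -> mpoly n R, forall a,
    l a = mpolyC n (peval (l a) z) + \sum_b m a b * centered z b.
  by have /choice[m mE] := fun a => hadamard z (l a); exists m.
(* Two applications of [hadamard] give a second order expansion whose matrix [m] need not be
   symmetric; symmetrizing keeps the form and makes its value at [z] half the Hessian. *)
exists (fun a b => 2^-1 *: (m a b + m b a)); split.
- rewrite {1}pE -addrA; congr (_ + _).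
  transitivity (\sum_a (mpolyC n (grad p z 0 a) * centered z a +
    \sum_b m a b * (centered z a * centered z b))).
    apply: eq_bigr => a _; rewrite {1}mE mulrDl lz; congr (_ + _).
    by rewrite mulr_suml; apply: eq_bigr => b _; rewrite mulrCA mulrC mulrA.
  rewrite big_split /=; congr (_ + _).
  set S := LHS; have SE : S = \sum_a \sum_b m b a * (centered z a * centered z b).
    rewrite /S exchange_big /=; apply: eq_bigr => a _; apply: eq_bigr => b _.
    by rewrite [centered z b * _]mulrC.
  have -> : qform (fun a b => 2^-1 *: (m a b + m b a)) (centered z) =
      2^-1 *: (S + S).
    rewrite {2}SE /S -big_split scaler_sumr; apply: eq_bigr => a _.
    rewrite -big_split scaler_sumr; apply: eq_bigr => b _.
    by rewrite -scalerAl mulrDl.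
  by rewrite scalerDr -scalerDl (_ : 2^-1 + 2^-1 = 1 :> R) ?scale1r //; lra.
- by move=> a b; rewrite addrC.
move=> a b; rewrite pevalZ mulrA mulfV ?pnatr_eq0 // mul1r !mxE.
have dE (c : 'I_n) : mderiv c p = l c + \sum_d mderiv c (l d) * centered z d.
  rewrite {1}pE mderivD mderivC add0r raddf_sum /=.
  rewrite (eq_bigr (fun d => l d * (d == c)%:R + mderiv c (l d) * centered z d)).
    rewrite big_split /=; congr (_ + _); rewrite (bigD1 c) //= eqxx mulr1 big1 ?addr0 //.
    by move=> d /negbTE->; rewrite mulr0.
  by move=> d _; rewrite mderivM mderiv_centered addrC.
have e1 c d : peval (mderiv d (l c)) z = peval (m c d) z.
  by rewrite (grad_hadamard (mE c)) mxE.
rewrite dE mderivD raddf_sum /= !pevalD e1; congr (_ + _).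
rewrite peval_sum (bigD1 b) //= big1 => [|d /negbTE ndb]; rewrite mderivM mderiv_centered.
  by rewrite eqxx mulr1 addr0 pevalD pevalM peval_centered subrr mulr0 add0r e1.
by rewrite ndb mulr0 addr0 pevalM peval_centered subrr mulr0.
Qed.

End PolynomialCalculus.

(** * Sums of squares and quadratic modules *)

Section Cones.
Variables (R : realType) (n : nat).
Implicit Types (p q s : mpoly n R).

Lemma sos_sqr p : sos (p ^+ 2).
Proof. by exists [:: p]; rewrite big_seq1. Qed.

Lemma sos0 : sos (0 : mpoly n R).
Proof. by exists [::]; rewrite big_nil. Qed.

Lemma sos1 : sos (1 : mpoly n R).
Proof. by rewrite -(expr1n _ 2); apply: sos_sqr. Qed.

Lemma sosD p q : sos p -> sos q -> sos (p + q).
Proof. by move=> [s ->] [t ->]; exists (s ++ t); rewrite big_cat. Qed.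

Lemma sosM p q : sos p -> sos q -> sos (p * q).
Proof.
move=> [s ->] [t ->]; exists [seq a * b | a <- s, b <- t].
rewrite big_allpairs_dep mulr_suml; apply: eq_bigr => a _.
by rewrite mulr_sumr; apply: eq_bigr => b _; rewrite exprMn.
Qed.

Lemma sos_sum (T : Type) (r : seq T) (Q : pred T) (F : T -> mpoly n R) :
  (forall i, Q i -> sos (F i)) -> sos (\sum_(i <- r | Q i) F i).
Proof. by move=> sF; apply: big_ind sF; [exact: sos0 | exact: sosD]. Qed.

Lemma sos_const (c : R) : 0 <= c -> sos (mpolyC n c).
Proof. by move=> c0; rewrite -(sqr_sqrtr c0) rmorphXn; apply: sos_sqr. Qed.

Definition sphere_poly : mpoly n R := \sum_(i < n) pvar R i ^+ 2 - 1.

(** Unlike a quadratic module in general, this set is closed under products, which admits the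
    products of 1 + x_i and 1 - x_i in the Bernstein basis. *)
Definition sos_sphere : set (mpoly n R) :=
  [set p | exists s q, sos s /\ p = s + sphere_poly * q].

Lemma sos_sphere_sos p : sos p -> sos_sphere p.
Proof. by move=> sp; exists p, 0; rewrite mulr0 addr0. Qed.

Lemma sos_sphereD p q : sos_sphere p -> sos_sphere q -> sos_sphere (p + q).
Proof.
move=> [s [a [ss ->]]] [t [b [st ->]]]; exists (s + t), (a + b).
by split; [exact: sosD | rewrite mulrDr addrACA].
Qed.

Lemma sos_sphereM p q : sos_sphere p -> sos_sphere q -> sos_sphere (p * q).
Proof.
move=> [s [a [ss ->]]] [t [b [st ->]]].
exists (s * t), (s * b + a * t + sphere_poly * a * b).
by split; [exact: sosM | ring].
Qed.

Lemma sos_sphere_sum (T : Type) (r : seq T) (Q : pred T) (F : T -> mpoly n R) :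
  (forall i, Q i -> sos_sphere (F i)) -> sos_sphere (\sum_(i <- r | Q i) F i).
Proof.
move=> sF; apply: big_ind sF; last exact: sos_sphereD.
exact: sos_sphere_sos sos0.
Qed.

Lemma sos_sphere_prod (T : Type) (r : seq T) (Q : pred T) (F : T -> mpoly n R) :
  (forall i, Q i -> sos_sphere (F i)) -> sos_sphere (\prod_(i <- r | Q i) F i).
Proof.
move=> sF; apply: big_ind sF; last exact: sos_sphereM.
exact: sos_sphere_sos sos1.
Qed.

Lemma sos_sphereXn p k : sos_sphere p -> sos_sphere (p ^+ k).
Proof.
move=> sp; elim: k => [|k IH]; first exact: sos_sphere_sos sos1.
by rewrite exprS; apply: sos_sphereM.
Qed.

(* On the sphere, 2 (1 + p) = (1 + p)^2 + 1 - p^2 and 1 - x_i^2 is the sum of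
   the other squares. *)
Lemma sos_sphere_1Dvar p (i : 'I_n) :
  p ^+ 2 = pvar R i ^+ 2 -> sos_sphere (1 + p).
Proof.
move=> p2.
exists (mpolyC n 2^-1 * ((1 + p) ^+ 2 + \sum_(j < n | j != i) pvar R j ^+ 2)).
exists (- mpolyC n 2^-1); split.
  apply: sosM; first by apply: sos_const; rewrite invr_ge0.
  by apply: sosD; [exact: sos_sqr | apply: sos_sum => j _; exact: sos_sqr].
rewrite /sphere_poly [\sum_(j < n) _](bigD1 i) //= -p2.
move: (\sum_(j < n | j != i) pvar R j ^+ 2) => S.
have h : mpolyC n 2^-1 * 2 = 1 :> mpoly n R.
  by rewrite -mpolyC_nat -mpolyCM mulVf ?pnatr_eq0 // mpolyC1.
transitivity (mpolyC n 2^-1 * 2 * (1 + p)); last by ring.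
by rewrite h mul1r.
Qed.

Lemma sos_sphere_1D (i : 'I_n) : sos_sphere (1 + pvar R i).
Proof. exact: sos_sphere_1Dvar. Qed.

Lemma sos_sphere_1B (i : 'I_n) : sos_sphere (1 - pvar R i).
Proof. by apply: (@sos_sphere_1Dvar _ i); rewrite sqrrN. Qed.

Section IdealPlusModule.
Variables (E I : finType) (h : E -> mpoly n R) (g : I -> mpoly n R).

Definition ideal_qm : set (mpoly n R) :=
  [set p + q | p in ideal_gen h & q in quadratic_module g].

Lemma ideal_qmD p q : ideal_qm p -> ideal_qm q -> ideal_qm (p + q).
Proof.
move=> [_ [a ->] [_ [s0 [s [ss0 ss ->]]] <-]].
move=> [_ [b ->] [_ [t0 [t [st0 st ->]]] <-]].
exists (\sum_i h i * (a i + b i)); first by exists (fun i => a i + b i).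
exists (s0 + t0 + \sum_j g j * (s j + t j)).
  exists (s0 + t0), (fun j => s j + t j); split=> //; first exact: sosD.
  by move=> j; apply: sosD.
under eq_bigr do rewrite mulrDr.
under [X in _ + (_ + X)]eq_bigr do rewrite mulrDr.
by rewrite !big_split /=; ring.
Qed.

Lemma ideal_qmMl s p : sos s -> ideal_qm p -> ideal_qm (s * p).
Proof.
move=> sos_s [_ [a ->] [_ [s0 [t [ss0 ss ->]]] <-]].
exists (\sum_i h i * (s * a i)); first by exists (fun i => s * a i).
exists (s * s0 + \sum_j g j * (s * t j)).
  exists (s * s0), (fun j => s * t j); split=> //; first exact: sosM.
  by move=> j; apply: sosM.
rewrite !mulrDr !mulr_sumr; congr (_ + (_ + _)).
  by apply: eq_bigr => i _; rewrite mulrCA.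
by apply: eq_bigr => j _; rewrite mulrCA.
Qed.

Lemma ideal_qm_sos s : sos s -> ideal_qm s.
Proof.
move=> ss; exists 0.
  by exists (fun=> 0); rewrite big1 // => i _; rewrite mulr0.
exists s; last by rewrite add0r.
exists s, (fun=> 0); split=> // [j|]; first exact: sos0.
by rewrite big1 ?addr0 // => j _; rewrite mulr0.
Qed.

Lemma ideal_qm_eq i q : ideal_qm (h i * q).
Proof.
exists (h i * q).
  exists (fun j => if j == i then q else 0).
  rewrite (bigD1 i) //= eqxx big1 ?addr0 // => j /negbTE ->; exact: mulr0.
exists 0; last by rewrite addr0.
exists 0, (fun=> 0); split; [exact: sos0 | by move=> _; exact: sos0 |].
by rewrite big1 ?addr0 // => j _; rewrite mulr0.
Qed.

Lemma ideal_qm_ineq j s : sos s -> ideal_qm (g j * s).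
Proof.
move=> ss; exists 0.
  by exists (fun=> 0); rewrite big1 // => i _; rewrite mulr0.
exists (g j * s); last by rewrite add0r.
exists 0, (fun k => if k == j then s else 0); split; first exact: sos0.
  by move=> k; case: ifP => // _; exact: sos0.
rewrite add0r (bigD1 j) //= eqxx big1 ?addr0 // => k /negbTE ->; exact: mulr0.
Qed.

Lemma ideal_qm_sum (T : Type) (r : seq T) (Q : pred T) (F : T -> mpoly n R) :
  (forall i, Q i -> ideal_qm (F i)) -> ideal_qm (\sum_(i <- r | Q i) F i).
Proof.
move=> sF; apply: big_ind sF; last exact: ideal_qmD.
exact: ideal_qm_sos sos0.
Qed.

Lemma ideal_qm_sos_sphere e p : h e = sphere_poly -> sos_sphere p -> ideal_qm p.
Proof.
move=> he [s [q [ss ->]]]; apply: ideal_qmD; first exact: ideal_qm_sos.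
by rewrite -he; apply: ideal_qm_eq.
Qed.

End IdealPlusModule.
End Cones.

(** * Bernstein expansions *)

(** Factorial moments of the binomial distribution, valid in any commutative ring: the induction
    shifts [k] by one through (k + 1) C(N + 1, k + 1) = (N + 1) C(N, k). *)
Lemma bernstein_ffact (A : comNzRingType) (x y : A) (N j : nat) : x + y = 1 ->
  \sum_(k < N.+1) (k ^_ j * 'C(N, k))%:R * (x ^+ k * y ^+ (N - k)) =
  (N ^_ j)%:R * x ^+ j.
Proof.
move=> xy1; elim: N j => [|N IH] [|j].
- by rewrite big_ord1 !expr0 !mulr1.
- by rewrite big_ord1 mul0r mul0r.
- have -> : (N.+1 ^_ 0)%:R * x ^+ 0 = (y + x) ^+ N.+1.
    by rewrite addrC xy1 expr1n ffactn0 expr0 mulr1.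
  rewrite exprDn; apply: eq_bigr => k _.
  by rewrite ffactn0 mul1n mulr_natl [x ^+ k * _]mulrC.
rewrite big_ord_recl mul0r add0r ffactSS natrM exprS mulrACA -IH.
rewrite [N.+1%:R * x]mulrC -mulrA !mulr_sumr; apply: eq_bigr => k _.
rewrite lift0 ffactSS subSS exprS.
have -> : (k.+1 * k ^_ j * 'C(N.+1, k.+1) = N.+1 * (k ^_ j * 'C(N, k)))%N.
  by rewrite mulnAC -(mul_bin_diag N.+1 k) -mulnA [('C(_, k) * _)%N]mulnC.
by rewrite natrM; ring.
Qed.

Section FallingRatio.
Variable R : realType.

Definition ffact_ratio (N j k : nat) : R := (k ^_ j)%:R / (N ^_ j)%:R.

Lemma ffact_ratio_itv N j k : (k <= N)%N -> 0 <= ffact_ratio N j k <= 1.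
Proof.
move=> kN; rewrite divr_ge0 ?ler0n //=.
have [Nj0|Nj0] := posnP (N ^_ j); first by rewrite /ffact_ratio Nj0 invr0 mulr0.
by rewrite ler_pdivrMr ?ltr0n // mul1r ler_nat -!bin_ffact leq_mul2r leq_bin2l ?orbT.
Qed.

(** The ratio is the product of the factors (k - i) / (N - i) for i < j, and each is within i / (N -
    i) of k / N, uniformly in [k]. *)
Lemma ffact_ratio_cvg j (e : R) : 0 < e -> \forall N \near \oo,
  forall k, (k <= N)%N -> `|ffact_ratio N j k - (k%:R / N%:R) ^+ j| <= e.
Proof.
elim: j e => [|j IH] e e0.
  by near=> N => k _; rewrite /ffact_ratio !ffactn0 divr1 expr0 subrr normr0 ltW.
have e20 : 0 < e / 2 by rewrite divr_gt0.
near=> N => k kN.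
have jN : (j < N)%N by near: N; exact: nbhs_infty_gt.
have IHN : forall k, (k <= N)%N ->
    `|ffact_ratio N j k - (k%:R / N%:R) ^+ j| <= e / 2.
  by near: N; exact: IH.
have jNe : j%:R <= e / 2 * (N - j)%:R.
  rewrite natrB 1?ltnW //.
  have : j%:R + j%:R / (e / 2) <= N%:R.
    by near: N; exact: nbhs_infty_ger.
  by rewrite -lerBrDl ler_pdivrMr // mulrC.
have Nj0 : 0 < (N - j)%:R :> R by rewrite ltr0n subn_gt0.
have N0 : 0 < N%:R :> R by rewrite ltr0n (leq_ltn_trans _ jN).
have -> : ffact_ratio N j.+1 k = ffact_ratio N j k * ((k - j)%:R / (N - j)%:R).
  by rewrite /ffact_ratio !ffactnSr !natrM invfM mulrACA.
have /andP[a0 a1] := ffact_ratio_itv j kN.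
have c0 : 0 <= k%:R / N%:R :> R by rewrite divr_ge0.
have c1 : k%:R / N%:R <= 1 :> R by rewrite ler_pdivrMr // mul1r ler_nat.
have bd : `|(k - j)%:R / (N - j)%:R - k%:R / N%:R| <= e / 2 :> R.
  apply: le_trans (_ : j%:R / (N - j)%:R <= _); last by rewrite ler_pdivrMr.
  have NE : N%:R = (N - j)%:R + j%:R :> R by rewrite -natrD subnK // ltnW.
  have [jk|/ltnW kj] := leqP j k.
    have kE : k%:R = (k - j)%:R + j%:R :> R by rewrite -natrD subnK.
    have kjN : (k - j)%:R <= (N - j)%:R :> R by rewrite ler_nat leq_sub2r.
    rewrite kE NE in N0 *; set a := (k - j)%:R; set d := (N - j)%:R.
    have -> : a / d - (a + j%:R) / (d + j%:R) =
        - (j%:R / d * ((d - a) / (d + j%:R))).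
      by field; rewrite !gt_eqF.
    rewrite normrN normrM ger0_norm ?divr_ge0 // ler_piMr ?divr_ge0 //.
    rewrite ger0_norm ?divr_ge0 ?subr_ge0 ?(ltW N0) // ler_pdivrMr // mul1r lerD2l.
    by rewrite (@le_trans _ _ 0) ?oppr_le0 /a ?ler0n.
  (* Here [k - j] is truncated to 0, and k / N itself is at most j / (N - j). *)
  rewrite (eqP kj) mul0r sub0r normrN ger0_norm //.
  by rewrite ler_pM ?invr_ge0 ?ler_nat // lef_pV2 ?posrE // ler_nat leq_subr.
rewrite exprSr.
move: (IHN k kN) bd a0 a1 c0 c1.
move: (ffact_ratio N j k) ((k - j)%:R / (N - j)%:R) => r s.
move: (k%:R / N%:R) ((k%:R / N%:R) ^+ j) => c t rt sc r0 r1 c0 c1.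
rewrite (_ : r * s - t * c = r * (s - c) + (r - t) * c); last by ring.
apply: le_trans (ler_normD _ _) _; rewrite (splitr e) lerD // normrM.
  by rewrite -[e / 2]mul1r ler_pM // ger0_norm.
by rewrite -[e / 2]mulr1 ler_pM // ger0_norm.
Unshelve. all: by end_near. Qed.

Lemma ordinal_ratio_itv N (k : 'I_N.+1) : 0 <= (k%:R / N%:R : R) <= 1.
Proof.
rewrite divr_ge0 //=; case: N k => [|N] k; first by rewrite invr0 mulr0.
by rewrite ler_pdivrMr ?ltr0n // mul1r ler_nat -ltnS.
Qed.

Lemma normr_prodB_le (I : finType) (a b : I -> R) :
  (forall i, 0 <= a i <= 1) -> (forall i, 0 <= b i <= 1) ->
  `|\prod_i a i - \prod_i b i| <= \sum_i `|a i - b i|.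
Proof.
move=> a01 b01.
suff [] : [/\ 0 <= \prod_i a i <= 1, 0 <= \prod_i b i <= 1 &
  `|\prod_i a i - \prod_i b i| <= \sum_i `|a i - b i| ] by [].
apply: (big_ind3 (fun x y z => [/\ 0 <= x <= 1, 0 <= y <= 1 & `|x - y| <= z])).
- by rewrite subrr normr0 !ler01 lexx.
- move=> x1 x2 x3 y1 y2 y3 [/andP[? ?] /andP[? ?] h1] [/andP[? ?] /andP[? ?] h2].
  split; rewrite ?mulr_ge0 ?mulr_ile1 //.
  rewrite (_ : _ - _ = x1 * (y1 - y2) + (x1 - x2) * y2); last by ring.
  apply: le_trans (ler_normD _ _) _; rewrite !normrM addrC lerD //.
    by rewrite -[x3]mulr1 ler_pM // ger0_norm.
  by rewrite -[y3]mul1r ler_pM // ger0_norm.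
by move=> i _.
Qed.

End FallingRatio.

Section Bernstein.
Variables (R : realType) (n : nat).
Implicit Types (p q : mpoly n R).

Definition half_plus (i : 'I_n) : mpoly n R := mpolyC n 2^-1 * (1 + pvar R i).
Definition half_minus (i : 'I_n) : mpoly n R := mpolyC n 2^-1 * (1 - pvar R i).

Lemma half_plusD i : half_plus i + half_minus i = 1.
Proof.
rewrite -mulrDr addrACA subrr addr0 -mpolyC1 -mpolyCD -mpolyCM.
by congr mpolyC; lra.
Qed.

(** The tensor Bernstein basis of degree [N] in each variable, transported from [0, 1] to [-1, 1] by
    (1 + x_i) / 2. *)
Definition bernstein_basis N (k : {ffun 'I_n -> 'I_N.+1}) : mpoly n R :=
  \prod_i (mpolyC n ('C(N, k i))%:R *
           (half_plus i ^+ k i * half_minus i ^+ (N - k i))).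

Lemma sos_sphere_bernstein N k : sos_sphere (@bernstein_basis N k).
Proof.
have c0 (c : R) : 0 <= c -> sos_sphere (mpolyC n c).
  by move=> c0; apply: sos_sphere_sos; apply: sos_const.
apply: sos_sphere_prod => i _; apply: sos_sphereM; first exact: c0.
apply: sos_sphereM; apply: sos_sphereXn; apply: sos_sphereM.
- by apply: c0; rewrite invr_ge0.
- exact: sos_sphere_1D.
- by apply: c0; rewrite invr_ge0.
- exact: sos_sphere_1B.
Qed.

(* Bernstein coefficients, exact once [N] exceeds the degree; they tend to the
   values of [q] at the nodes, since the ratios of falling factorials tend to
   powers. *)
Definition bernstein_coef q N (k : {ffun 'I_n -> 'I_N.+1}) : R :=
  \sum_(m <- msupp q) mcoeff m q * \prod_i ffact_ratio R N (m i) (k i).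

Lemma msupp_coord_lt q m i : m \in msupp q -> (m i < mmeasure mdeg q)%N.
Proof.
move=> mq; apply: leq_ltn_trans (msize_mdeg_lt mq).
by rewrite mdegE (bigD1 i) //= leq_addr.
Qed.

Lemma bernstein_expansion q : \forall N \near \oo,
  comp_mpoly [tuple half_plus i | i < n] q =
  \sum_k mpolyC n (@bernstein_coef q N k) * bernstein_basis k.
Proof.
near=> N.
have qN : (mmeasure mdeg q <= N)%N by near: N; exact: nbhs_infty_ge.
rewrite comp_mpolyEX /bernstein_coef.
under [RHS]eq_bigr do rewrite raddf_sum mulr_suml.
rewrite exchange_big /= big_seq [RHS]big_seq; apply: eq_bigr => m mq.
under [RHS]eq_bigr do rewrite mpolyCM -mulrA.
rewrite -mulr_sumr -mul_mpolyC comp_mpolyX; congr (_ * _).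
transitivity (\prod_(i < n) \sum_(k < N.+1) mpolyC n (ffact_ratio R N (m i) k) *
   (mpolyC n 'C(N, k)%:R * (half_plus i ^+ k * half_minus i ^+ (N - k)))).
  apply: eq_bigr => i _; rewrite tnth_mktuple.
  have miN : (m i <= N)%N by apply: ltnW (leq_trans (msupp_coord_lt i mq) _).
  have Nm0 : (N ^_ m i)%:R != 0 :> R by rewrite pnatr_eq0 -lt0n ffact_gt0.
  rewrite -[LHS]mul1r -mpolyC1 -[X in mpolyC n X * _ = _](mulVf Nm0) mpolyCM -mulrA mpolyC_nat.
  rewrite -(bernstein_ffact N (m i) (half_plusD i)) mulr_sumr.
  apply: eq_bigr => k _; rewrite !mulrA; congr (_ * _ * _).
  by rewrite natrM -!mpolyC_nat -!mpolyCM; rewrite mulrA [_^-1 * _]mulrC.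
rewrite bigA_distr_bigA /=; apply: eq_bigr => k _.
by rewrite big_split /= rmorph_prod.
Unshelve. all: by end_near. Qed.

Lemma bernstein_coef_cvg q (e : R) : 0 < e -> \forall N \near \oo, forall k,
  `|@bernstein_coef q N k - peval q (\row_i ((k i)%:R / N%:R))| <= e.
Proof.
move=> e0; pose C := 1 + \sum_(m <- msupp q) `|mcoeff m q| * n%:R.
have C0 : 0 < C by rewrite ltr_pwDl ?ltr01 // sumr_ge0 // => m _; rewrite mulr_ge0.
have eC0 : 0 < e / C by rewrite divr_gt0.
near=> N => k.
have H (j : 'I_(mmeasure mdeg q)) : forall k, (k <= N)%N ->
    `|ffact_ratio R N j k - (k%:R / N%:R) ^+ j| <= e / C.
  by move: j; near: N; apply: filter_forall => j; exact: ffact_ratio_cvg.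
rewrite /peval mevalE -sumrB; apply: le_trans (ler_norm_sum _ _ _) _.
apply: (@le_trans _ _ (\sum_(m <- msupp q) `|mcoeff m q| * n%:R * (e / C))).
  rewrite big_seq [leRHS]big_seq ler_sum // => m mq.
  rewrite -mulrBr normrM -mulrA ler_wpM2l //.
  apply: le_trans (normr_prodB_le _ _) _ => [i|i|].
  - by apply: ffact_ratio_itv; rewrite -ltnS.
  - have /andP[kN0 kN1] := @ordinal_ratio_itv R _ (k i).
    by rewrite mxE exprn_ge0 //= exprn_ile1.
  - rewrite -[n in leRHS]card_ord mulr_natl -sumr_const ler_sum // => i _.
    by rewrite mxE (H (Ordinal (msupp_coord_lt i mq))) // -ltnS.
by rewrite -mulr_suml mulrCA ler_piMr ?(ltW e0) // ler_pdivrMr // mul1r lerDr.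
Unshelve. all: by end_near. Qed.

(** [q] is [p] after the inverse change of variable; the Bernstein expansion is then applied to [q]
    at (1 + x_i) / 2. *)
Lemma comp_half_plus p : exists q,
  comp_mpoly [tuple half_plus i | i < n] q = p /\
  forall u, peval q u = peval p (\row_i (2 * u 0 i - 1)).
Proof.
elim/mpoly_ringind: p => [c|i|p1 p2 [q1 [e1 f1]] [q2 [e2 f2]]|p1 p2 [q1 [e1 f1]] [q2 [e2 f2]]].
- by exists (mpolyC n c); rewrite comp_mpolyC; split=> // u; rewrite !pevalC.
- exists (mpolyC n 2 * pvar R i - mpolyC n 1); split=> [|u]; last first.
    by rewrite !pevalE mxE.
  rewrite comp_mpolyB rmorphM /= !comp_mpolyC comp_mpolyXU -tnth_nth tnth_mktuple.
  rewrite mulrA -mpolyCM divff ?pnatr_eq0 // mpolyC1 mul1r addrC.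
  by rewrite addrA [- 1 + 1]addrC subrr add0r.
- exists (q1 + q2); rewrite comp_mpolyD e1 e2; split=> // u.
  by rewrite !pevalD f1 f2.
- exists (q1 * q2); rewrite rmorphM /= e1 e2; split=> // u.
  by rewrite !pevalM f1 f2.
Qed.

Definition bernstein_node N (k : {ffun 'I_n -> 'I_N.+1}) : 'rV[R]_n :=
  \row_i (2 * ((k i)%:R / N%:R) - 1).

Lemma bernstein_node_itv N k i : `|@bernstein_node N k 0 i| <= 1.
Proof.
by rewrite mxE ler_norml; have /andP[] := @ordinal_ratio_itv R _ (k i); lra.
Qed.

Lemma bernstein_approx p :
  exists c : forall N, {ffun 'I_n -> 'I_N.+1} -> R,
  (\forall N \near \oo, p = \sum_k mpolyC n (c N k) * bernstein_basis k) /\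
  (forall e, 0 < e -> \forall N \near \oo, forall k,
     `|c N k - peval p (bernstein_node k)| <= e).
Proof.
have [q [qp pq]] := comp_half_plus p; exists (bernstein_coef q).
split=> [|e e0]; first by rewrite -qp; exact: bernstein_expansion.
near=> N => k; suff -> : bernstein_node k = \row_i (2 * (\row_i ((k i)%:R / N%:R)) 0 i - 1).
  by rewrite -pq; move: k; near: N; exact: bernstein_coef_cvg.
by apply/rowP => i; rewrite !mxE.
Unshelve. all: by end_near. Qed.

End Bernstein.

(** * Quadratic forms *)

Section QuadraticForms.
Variables (A : comNzRingType) (r : nat).
Implicit Types (P Q : 'I_r -> 'I_r -> A) (v l : 'I_r -> A).

Lemma eq_qform P Q v : (forall a b, P a b = Q a b) -> qform P v = qform Q v.
Proof.
by move=> PQ; apply: eq_bigr => a _; apply: eq_bigr => b _; rewrite PQ.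
Qed.

Lemma qformD P Q v : qform (fun a b => P a b + Q a b) v = qform P v + qform Q v.
Proof.
rewrite -big_split; apply: eq_bigr => a _; rewrite -big_split.
by apply: eq_bigr => b _; rewrite mulrDl.
Qed.

Lemma qformMl c P v : qform (fun a b => c * P a b) v = c * qform P v.
Proof.
rewrite mulr_sumr; apply: eq_bigr => a _; rewrite mulr_sumr.
by apply: eq_bigr => b _; rewrite -mulrA.
Qed.

Lemma qform_sum (T : Type) (s : seq T) (F : pred T) (P : T -> 'I_r -> 'I_r -> A) v :
  qform (fun a b => \sum_(i <- s | F i) P i a b) v = \sum_(i <- s | F i) qform (P i) v.
Proof.
rewrite exchange_big; apply: eq_bigr => a _; rewrite exchange_big.
by apply: eq_bigr => b _; rewrite mulr_suml.
Qed.

Lemma qform_rank1 l v : qform (fun a b => l a * l b) v = (\sum_a l a * v a) ^+ 2.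
Proof.
rewrite expr2 mulr_suml; apply: eq_bigr => a _; rewrite mulr_sumr.
by apply: eq_bigr => b _; rewrite mulrACA.
Qed.

Lemma qform_id v : qform (fun a b => (a == b)%:R) v = \sum_a v a ^+ 2.
Proof.
apply: eq_bigr => a _; rewrite (bigD1 a) //= eqxx mul1r big1 ?addr0 ?expr2 //.
by move=> b ba; rewrite eq_sym (negbTE ba) mul0r.
Qed.

Lemma qformZr c P v : qform P (fun a => c * v a) = c ^+ 2 * qform P v.
Proof.
rewrite mulr_sumr; apply: eq_bigr => a _; rewrite mulr_sumr.
by apply: eq_bigr => b _; ring.
Qed.

End QuadraticForms.

Lemma qform_recl (A : comNzRingType) r (P : 'I_r.+1 -> 'I_r.+1 -> A) v :
  (forall a b, P a b = P b a) ->
  qform P v = P ord0 ord0 * v ord0 ^+ 2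
    + 2 * v ord0 * (\sum_a P ord0 (lift ord0 a) * v (lift ord0 a))
    + qform (fun a b => P (lift ord0 a) (lift ord0 b)) (fun a => v (lift ord0 a)).
Proof.
move=> Psym; set S := \sum_a _; set Q := (X in _ = _ + X).
have e1 : \sum_b P ord0 (lift ord0 b) * (v ord0 * v (lift ord0 b)) = v ord0 * S.
  by rewrite mulr_sumr; apply: eq_bigr => b _; rewrite mulrCA.
have e2 : \sum_a \sum_b P (lift ord0 a) b * (v (lift ord0 a) * v b) = v ord0 * S + Q.
  rewrite mulr_sumr -big_split; apply: eq_bigr => a _.
  by rewrite big_ord_recl /= Psym mulrA mulrC.
by rewrite /qform big_ord_recl e2 big_ord_recl e1; ring.
Qed.

Section PositiveDefinite.
Variable R : realType.

(** Cholesky's decomposition: complete the square in the first coordinate and apply induction to the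
    Schur complement [D]. *)
Lemma pd_sum_squares r (C : 'I_r -> 'I_r -> R) :
  (forall a b, C a b = C b a) ->
  (forall v, (exists a, v a != 0) -> 0 < qform C v) ->
  exists w : 'I_r -> 'I_r -> R, forall a b, C a b = \sum_i w i a * w i b.
Proof.
elim: r C => [|r IH] C Csym Cpos; first by exists (fun _ _ => 0) => -[].
have c0 : 0 < C ord0 ord0.
  have /Cpos : exists a : 'I_r.+1, (a == ord0)%:R != 0 :> R.
    by exists ord0; rewrite oner_eq0.
  rewrite qform_recl // eqxx expr1n mulr1 big1 => [|a _]; last by rewrite mulr0.
  rewrite mulr0 addr0 /qform big1 ?addr0 // => a _.
  by rewrite big1 // => b _; rewrite /= !mulr0.
set c := C ord0 ord0 in c0; pose l a := C ord0 (lift ord0 a).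
pose D a b := C (lift ord0 a) (lift ord0 b) + (- c^-1) * (l a * l b).
have [|v [a va]|w wE] := IH D; first by move=> a b; rewrite /D Csym [l b * _]mulrC.
  (* [t] minimizes the form in the first coordinate with the others fixed at [v]; the minimum is the
     value of the Schur complement. *)
  pose t := - (\sum_a l a * v a) / c.
  pose v' i := if unlift ord0 i is Some j then v j else t.
  have v'S i : v' (lift ord0 i) = v i by rewrite /v' liftK.
  have v'0 : v' ord0 = t by rewrite /v' unlift_none.
  have /Cpos : exists a, v' a != 0 by exists (lift ord0 a); rewrite v'S.
  rewrite qform_recl // -/c v'0 qformD qformMl qform_rank1.
  under eq_bigr do rewrite v'S.
  have -> : qform (fun a b => C (lift ord0 a) (lift ord0 b))
      (fun a => v' (lift ord0 a)) = qform (fun a b => C (lift ord0 a) (lift ord0 b)) v.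
    by apply: eq_bigr => i _; apply: eq_bigr => j _; rewrite !v'S.
  move: (qform _ v) => q; rewrite -/(l _) /t; set S := \sum_a _.
  suff -> : c * (- S / c) ^+ 2 + 2 * (- S / c) * S + q = q - c^-1 * S ^+ 2 by rewrite mulNr.
  by field; rewrite gt_eqF.
pose s := Num.sqrt c; have s2 : s * s = c by rewrite -expr2 sqr_sqrtr ?ltW.
have s0 : s != 0 by rewrite gt_eqF // sqrtr_gt0.
exists (fun i a => if unlift ord0 i is Some i' then
  (if unlift ord0 a is Some a' then w i' a' else 0) else C ord0 a / s) => a b.
rewrite big_ord_recl unlift_none.
under eq_bigr do rewrite liftK.
have e0 x : x / s * (c / s) = x by rewrite -s2; field.
case: (unliftP ord0 a) => [a'|] ->; case: (unliftP ord0 b) => [b'|] ->.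
- by rewrite -wE /D -s2 /l; field.
- by rewrite big1 => [|i _]; [rewrite addr0 Csym e0 | rewrite mulr0].
- by rewrite big1 => [|i _]; [rewrite addr0 mulrC e0 | rewrite mul0r].
- by rewrite big1 => [|i _]; [rewrite addr0 e0 | rewrite mul0r].
Qed.

Lemma sos_qform n r (C : 'I_r -> 'I_r -> R) (f : 'I_r -> mpoly n R) :
  (forall a b, C a b = C b a) ->
  (forall v, (exists a, v a != 0) -> 0 < qform C v) ->
  sos (qform (fun a b => mpolyC n (C a b)) f).
Proof.
move=> Csym Cpos; have [w wE] := pd_sum_squares Csym Cpos.
rewrite (@eq_qform _ _ _ (fun a b => \sum_i mpolyC n (w i a) * mpolyC n (w i b))).
  rewrite qform_sum; apply: sos_sum => i _.
  by rewrite (qform_rank1 (fun a => mpolyC n (w i a))); exact: sos_sqr.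
by move=> a b; rewrite wE raddf_sum; apply: eq_bigr => i _; rewrite /= mpolyCM.
Qed.

End PositiveDefinite.

(** * Compactness *)

Section Compactness.
Variable R : realType.

(** Positivity for one index persists near [x] by continuity, then for all larger indices by
    monotonicity; compactness makes the index uniform. *)
Lemma dini_positive (T : topologicalType) (K : set T) (phi : nat -> T -> R) :
  compact K -> (forall N, continuous (phi N)) ->
  (forall x N M, K x -> (N <= M)%N -> phi N x <= phi M x) ->
  (forall x, K x -> exists N, 0 < phi N x) ->
  exists N, forall x, K x -> 0 < phi N x.
Proof.
move=> cK cphi mono pos.
have /compact_near_coveringP/near_covering_withinP ncK := cK.
have [x Kx|N _ HN] := ncK _ \oo (fun N x => 0 < phi N x).
  have [N0 N0x] := pos x Kx; near=> x' N => /= Kx'.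
  apply: lt_le_trans (mono x' N0 N Kx' _).
    near: x'; apply: cvgr_gt N0x; exact: cphi.
  by near: N; exact: nbhs_infty_ge.
by exists N; apply: HN => /=.
Unshelve. all: by end_near. Qed.

Lemma continuous_sumr (T : topologicalType) (I : Type) (s : seq I)
    (F : I -> T -> R) :
  (forall i, continuous (F i)) -> continuous (fun x => \sum_(i <- s) F i x).
Proof.
move=> cF; elim: s => [|i s IH] x.
  rewrite (_ : (fun x => _) = cst 0); first exact: cst_continuous.
  by apply/funext => y; rewrite big_nil.
rewrite (_ : (fun x => _) = F i \+ (fun x => \sum_(i <- s) F i x)).
  exact: continuousD (cF i x) (IH x).
by apply/funext => y; rewrite big_cons.
Qed.

Definition cube n : set 'rV[R]_n := [set x | forall i, `|x 0 i| <= 1].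

Definition usphere n : set 'rV[R]_n := [set x | \sum_i x 0 i ^+ 2 = 1].

Lemma compact_cube n : compact (@cube n).
Proof.
rewrite (_ : @cube n = [set v : 'rV[R]_n | forall i, `[-1, 1]%classic (v ord0 i)]).
  by apply: (@rV_compact _ n (fun=> `[(-1 : R), 1]%classic)) => i; exact: segment_compact.
apply/seteqP; split => x /= H i; have := H i;
  by rewrite in_itv /= ler_norml.
Qed.

Lemma usphere_cube n : @usphere n `<=` @cube n.
Proof.
move=> x /= x1 i; rewrite -(@expr_le1 _ 2) // real_normK ?num_real //.
by rewrite -x1 (bigD1 i) //= lerDl sumr_ge0 // => j _; rewrite sqr_ge0.
Qed.

Lemma closed_le_continuous (T : topologicalType) (f : T -> R) (c : R) :
  continuous f -> closed [set x | f x <= c].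
Proof.
move=> cf; apply: (@closed_comp _ _ f [set y | y <= c]); last exact: closed_le.
by move=> x _; exact: cf.
Qed.

Lemma closed_eq_continuous (T : topologicalType) (f : T -> R) (c : R) :
  continuous f -> closed [set x | f x = c].
Proof.
move=> cf; apply: (@closed_comp _ _ f [set y | y = c]); last exact: closed_eq.
by move=> x _; exact: cf.
Qed.

Lemma continuous_coord n (i : 'I_n) : continuous (fun x : 'rV[R]_n => x 0 i).
Proof. exact: coord_continuous. Qed.

Lemma compact_usphere n : compact (@usphere n).
Proof.
apply: subclosed_compact (@usphere_cube n); last exact: compact_cube.
apply: closed_eq_continuous; apply: continuous_sumr => i x.
rewrite (_ : (fun x => _) = (fun x : 'rV[R]_n => x 0 i) \* (fun x : 'rV[R]_n => x 0 i)).
  exact: continuousM (@continuous_coord n i x) (@continuous_coord n i x).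
by apply/funext => y; rewrite expr2.
Qed.

Definition matform n r (P : 'I_r -> 'I_r -> mpoly n R) (x : 'rV[R]_n) (v : 'rV[R]_r) : R :=
  qform (fun a b => peval (P a b) x) (v 0).

Lemma matform_peval n r (P : 'I_r -> 'I_r -> mpoly n R) x (v : 'rV[R]_r) :
  matform P x v = peval (qform P (fun a => mpolyC n (v 0 a))) x.
Proof.
rewrite peval_qform; apply: eq_bigr => a _; apply: eq_bigr => b _.
by rewrite !pevalC.
Qed.

Lemma continuous_matform n r (P : 'I_r -> 'I_r -> mpoly n R) :
  continuous (fun xv : 'rV[R]_n * 'rV[R]_r => matform P xv.1 xv.2).
Proof.
apply: continuous_sumr => a; apply: continuous_sumr => b.
have cv c : continuous (fun xv : 'rV[R]_n * 'rV[R]_r => xv.2 0 c).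
  move=> xv; apply: (@continuous_comp _ _ _ snd (fun v : 'rV[R]_r => v 0 c)).
    exact: cvg_snd.
  exact: continuous_coord.
have cp : continuous (fun xv : 'rV[R]_n * 'rV[R]_r => peval (P a b) xv.1).
  move=> xv; apply: (@continuous_comp _ _ _ fst (fun x : 'rV[R]_n => peval (P a b) x)).
    exact: cvg_fst.
  exact: continuous_peval.
move=> xv; exact: continuousM (cp xv) (continuousM (cv a xv) (cv b xv)).
Qed.

End Compactness.

(** * Positive definite polynomial matrices *)

Section MatrixPositivstellensatz.
Variables (R : realType) (n r : nat).

Lemma compact_cube_usphere : compact (@cube R n `*` @usphere R r).
Proof. by apply: compact_setX; [exact: compact_cube | exact: compact_usphere]. Qed.

(** The form minus 1 / (N + 1) increases with [N], so Dini's argument yields the margin [eta]. This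
    route, unlike the extreme value theorem, also covers the empty sphere [r = 0]. *)
Lemma matform_lower_bound (P : 'I_r -> 'I_r -> mpoly n R) :
  (forall x v, @cube R n x -> @usphere R r v -> 0 < matform P x v) ->
  exists2 eta : R, 0 < eta &
    forall x v, @cube R n x -> @usphere R r v -> eta < matform P x v.
Proof.
move=> Ppos.
have [|||N HN] := @dini_positive R _ _
  (fun N (xv : 'rV[R]_n * 'rV[R]_r) => matform P xv.1 xv.2 - N.+1%:R^-1)
  compact_cube_usphere.
- move=> N; rewrite (_ : (fun xv => _) =
    (fun xv : 'rV[R]_n * 'rV[R]_r => matform P xv.1 xv.2) \- cst (N.+1%:R^-1)) // => xv.
  by apply: cvgB; [exact: continuous_matform | exact: cvg_cst].
- by move=> x N M _ NM; rewrite lerD2l lerN2 lef_pV2 ?posrE ?ler_nat.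
- move=> [x v] [/= cx sv]; have Pxv := Ppos x v cx sv.
  exists (Num.truncn (matform P x v)^-1); rewrite subr_gt0 invf_plt ?posrE //.
  by apply: truncnS_gt.
exists N.+1%:R^-1; first by rewrite invr_gt0.
by move=> x v cx sv; rewrite -subr_gt0; apply: (HN (x, v)).
Qed.

Lemma usphere_normalize (v : 'I_r -> R) : (exists a, v a != 0) ->
  exists t (u : 'rV[R]_r), [/\ 0 < t, @usphere R r u & forall a, v a = t * u 0 a].
Proof.
move=> [a0 va0]; pose t := Num.sqrt (\sum_a v a ^+ 2).
have t20 : 0 < \sum_a v a ^+ 2.
  rewrite (bigD1 a0) //= ltr_pwDl ?exprn_even_gt0 //.
  by rewrite sumr_ge0 // => b _; rewrite sqr_ge0.
have t0 : 0 < t by rewrite sqrtr_gt0.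
exists t, (\row_a (t^-1 * v a)); split=> // [|a]; last by rewrite mxE mulVKf ?gt_eqF.
rewrite /usphere /=; under eq_bigr do rewrite mxE exprMn.
by rewrite -mulr_sumr -[X in _ * X]sqr_sqrtr ?(ltW t20) // -exprMn mulVf ?gt_eqF ?expr1n.
Qed.

Lemma qform_pos_usphere (C : 'I_r -> 'I_r -> R) :
  (forall u, @usphere R r u -> 0 < qform C (u 0)) ->
  forall v, (exists a, v a != 0) -> 0 < qform C v.
Proof.
move=> Cpos v /usphere_normalize[t [u [t0 su vE]]].
have -> : qform C v = t ^+ 2 * qform C (u 0).
  by rewrite -qformZr; apply: eq_bigr => a _; apply: eq_bigr => b _; rewrite -!vE.
by rewrite mulr_gt0 ?exprn_gt0 ?Cpos.
Qed.

(** On the unit sphere each of the r * r products v_a v_b is at most 1 in absolute value, so the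
    total perturbation is at most [eta]. The successor keeps the tolerance positive for [r = 0]. *)
Lemma pd_perturb (C D : 'I_r -> 'I_r -> R) (eta : R) : 0 < eta ->
  (forall v, @usphere R r v -> eta < qform C (v 0)) ->
  (forall a b, `|D a b - C a b| <= eta / (r * r).+1%:R) ->
  forall v, (exists a, v a != 0) -> 0 < qform D v.
Proof.
move=> eta0 Cpos CD; apply: qform_pos_usphere => u su.
have -> : qform D (u 0) = qform C (u 0) + qform (fun a b => D a b - C a b) (u 0).
  by rewrite -qformD; apply: eq_qform => a b; rewrite addrC subrK.
have : `|qform (fun a b => D a b - C a b) (u 0)| <= eta.
  apply: le_trans (_ : \sum_(a < r) \sum_(b < r) eta / (r * r).+1%:R <= _).
    apply: le_trans (ler_norm_sum _ _ _) _; apply: ler_sum => a _.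
    apply: le_trans (ler_norm_sum _ _ _) _; apply: ler_sum => b _.
    rewrite normrM -[leRHS]mulr1 ler_pM // normrM mulr_ile1 //.
      exact: (usphere_cube su a).
    exact: (usphere_cube su b).
  rewrite !sumr_const !card_ord -mulrnA -[leLHS]mulr_natr mulrAC -mulrA.
  rewrite ler_piMr ?(ltW eta0) // ler_pdivrMr ?ltr0n // mul1r ler_nat.
  by rewrite leqW.
by rewrite ler_norml => /andP[+ _]; have := Cpos u su; lra.
Qed.

(* In the Bernstein expansion of [P] all coefficient matrices are eventually
   positive definite, and the basis polynomials are products of the
   [1 + x_i] and [1 - x_i], which are sums of squares on the sphere. *)
Lemma matrix_positivstellensatz (P : 'I_r -> 'I_r -> mpoly n R)
    (f : 'I_r -> mpoly n R) :
  (forall a b, P a b = P b a) ->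
  (forall x v, @cube R n x -> @usphere R r v -> 0 < matform P x v) ->
  sos_sphere (qform P f).
Proof.
move=> Psym /matform_lower_bound[eta eta0 Peta].
have /choice[c cP] := @bernstein_approx R n.
have e0 : 0 < eta / (r * r).+1%:R by rewrite divr_gt0.
have [N [NE Ne]] : exists N,
    (forall a b, P a b = \sum_k mpolyC n (c (P a b) N k) * bernstein_basis R k) /\
    (forall a b k, `|c (P a b) N k - peval (P a b) (bernstein_node R k)| <= eta / (r * r).+1%:R).
  have [N1 _ H1] : \forall N \near \oo, forall a b,
      P a b = \sum_k mpolyC n (c (P a b) N k) * bernstein_basis R k.
    apply: filter_forall => a; apply: filter_forall => b.
    by have [] := cP (P a b).
  have [N2 _ H2] : \forall N \near \oo, forall a b k,
      `|c (P a b) N k - peval (P a b) (bernstein_node R k)| <= eta / (r * r).+1%:R.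
    apply: filter_forall => a; apply: filter_forall => b.
    by have [_] := cP (P a b); apply.
  exists (maxn N1 N2); split; first by apply: H1; rewrite /= leq_maxl.
  by apply: H2; rewrite /= leq_maxr.
rewrite (eq_qform _ NE) qform_sum; apply: sos_sphere_sum => k _.
rewrite (@eq_qform _ _ _ (fun a b => bernstein_basis R k * mpolyC n (c (P a b) N k))).
  rewrite qformMl; apply: sos_sphereM; first exact: sos_sphere_bernstein.
  apply: sos_sphere_sos; apply: sos_qform; first by move=> a b; rewrite Psym.
  apply: (pd_perturb eta0 _ (fun a b => Ne a b k)) => v sv; apply: Peta => // i.
  exact: bernstein_node_itv.
by move=> a b; rewrite mulrC.
Qed.

End MatrixPositivstellensatz.

(** * Penalization with one active set *)

Section ExponentialWeights.
Variable R : realType.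
Implicit Types t : R.

(** For t >= 0 the base is at most 1 and the power decreases; for t < 0 the base exceeds 1 and the
    growing power multiplies a negative number. *)
Lemma weight_mono t N M : `|t| <= 2^-1 -> (N <= M)%N ->
  (1 - t) ^+ (2 * M) * t <= (1 - t) ^+ (2 * N) * t.
Proof.
rewrite ler_norml => /andP[tm tM] NM.
have [t0|/ltW t0] := leP 0 t.
  by apply: ler_wpM2r => //; apply: ler_wiXn2l; rewrite ?leq_mul2l //; lra.
by apply: ler_wnM2r => //; apply: ler_weXn2l; rewrite ?leq_mul2l //; lra.
Qed.

Lemma weight_geometric t N :
  t * \sum_(i < 2 * N) (1 - t) ^+ i = 1 - (1 - t) ^+ (2 * N).
Proof.
have := subrX1 (1 - t) (2 * N); rewrite addrAC subrr add0r mulNr => h.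
by rewrite -[RHS]opprB h opprK.
Qed.

(** (1 - t)^(2N) is at most each of the 2N terms of the geometric sum, and [t] times that sum is at
    most 1; so the weight is at most 1 / (2N). *)
Lemma weight_small t (e : R) : 0 <= t -> `|t| <= 2^-1 -> 0 < e ->
  \forall N \near \oo, (1 - t) ^+ (2 * N) * t <= e.
Proof.
move=> t0 tle e0; near=> N.
have t1 : t <= 1 by move: tle; rewrite ger0_norm //; lra.
have h : (2 * N)%:R * ((1 - t) ^+ (2 * N) * t) <= 1.
  apply: (@le_trans _ _ (t * \sum_(i < 2 * N) (1 - t) ^+ i)); last first.
    by rewrite weight_geometric gerBl exprn_ge0 // subr_ge0.
  rewrite mulrA mulrC ler_wpM2l // mulr_natl -[X in _ *+ X]card_ord -sumr_const.
  apply: ler_sum => i _; apply: ler_wiXn2l; rewrite ?subr_ge0 //; first by lra.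
  exact: ltnW.
have N0 : 0 < (2 * N)%:R :> R.
  by rewrite ltr0n muln_gt0 /=; near: N; exact: nbhs_infty_gt.
have Ne : e^-1 <= (2 * N)%:R.
  apply: (@le_trans _ _ N%:R); first by near: N; exact: nbhs_infty_ger.
  by rewrite ler_nat leq_pmull.
rewrite -(ler_pM2l N0); apply: le_trans h _.
by rewrite -ler_pdivrMr // div1r.
Unshelve. all: by end_near. Qed.

(** Bernoulli's inequality: the power is at least 1 + 2N (- t). *)
Lemma weight_large t (B : R) : t < 0 ->
  \forall N \near \oo, B <= - ((1 - t) ^+ (2 * N) * t).
Proof.
move=> t0; near=> N; rewrite -mulrN.
have nt0 : 0 < - t by rewrite oppr_gt0.
apply: le_trans (_ : N%:R * (- t) * (- t) <= _).
  rewrite -!ler_pdivrMr //; near: N; exact: nbhs_infty_ger.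
rewrite ler_wpM2r ?(ltW nt0) //.
have h : 1 + (2 * N)%:R * (- t) <= (1 - t) ^+ (2 * N).
  elim: (2 * N)%N => [|k IH]; first by rewrite mul0r addr0.
  rewrite exprS; apply: le_trans (_ : (1 - t) * (1 + k%:R * - t) <= _); last first.
    by rewrite ler_wpM2l //; lra.
  have : 0 <= k%:R * t ^+ 2 by rewrite mulr_ge0 ?sqr_ge0.
  by rewrite -natr1; nra.
apply: le_trans h; have : 0 <= N%:R * - t by rewrite mulr_ge0 // ltW.
by rewrite natrM; lra.
Unshelve. all: by end_near. Qed.

End ExponentialWeights.

Section PointwisePenalty.
Variables (R : realType) (r : nat) (E I : finType).
Variables (q : 'I_r -> 'I_r -> R) (lE : E -> 'I_r -> R) (lI : I -> 'I_r -> R).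
Variables (act : pred I) (lam g : I -> R) (f v : 'I_r -> R) (kap s : R).

Let dot (l w : 'I_r -> R) := \sum_a l a * w a.

(* The term [sum_a (f a - (f . v) v a)^2] is [|f|^2 - (f . v)^2] for a unit
   vector [v]: it vanishes only for [v] parallel to [f], and contributes nothing
   when [v] is replaced by [f]. *)
Definition penalized_value (N : nat) : R :=
  qform q v
  + N%:R * (\sum_i dot (lE i) v ^+ 2 + \sum_a (f a - dot f v * v a) ^+ 2 + s ^+ 2)
  + \sum_(j | act j) lam j * kap *
      (\sum_(i < 2 * N) (1 - kap * g j) ^+ i) * dot (lI j) v ^+ 2
  - \sum_(j | ~~ act j) (\sum_a f a ^+ 2) * ((1 - kap * g j) ^+ (2 * N) * g j).

Hypothesis kap0 : 0 < kap.
Hypothesis kapg : forall j, `|kap * g j| <= 2^-1.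
Hypothesis lam0 : forall j, act j -> 0 < lam j.

Let gE j N : (1 - kap * g j) ^+ (2 * N) * g j =
  kap^-1 * ((1 - kap * g j) ^+ (2 * N) * (kap * g j)).
Proof. by rewrite [RHS]mulrCA mulKf ?gt_eqF. Qed.

Let D0 : 0 <= \sum_a f a ^+ 2.
Proof. by apply: sumr_ge0 => a _; exact: sqr_ge0. Qed.

Let X0 : 0 <= \sum_i dot (lE i) v ^+ 2 + \sum_a (f a - dot f v * v a) ^+ 2 + s ^+ 2.
Proof. by rewrite !addr_ge0 ?sqr_ge0 // sumr_ge0 // => a _; exact: sqr_ge0. Qed.

Let kg1 j : 0 <= 1 - kap * g j.
Proof. by have := kapg j; rewrite ler_norml => /andP[_]; lra. Qed.

Let Zmono N M : (N <= M)%N ->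
  - \sum_(j | ~~ act j) (\sum_a f a ^+ 2) * ((1 - kap * g j) ^+ (2 * N) * g j) <=
  - \sum_(j | ~~ act j) (\sum_a f a ^+ 2) * ((1 - kap * g j) ^+ (2 * M) * g j).
Proof.
move=> NM; rewrite lerN2; apply: ler_sum => j _; rewrite ler_wpM2l // !gE.
by rewrite ler_wpM2l ?invr_ge0 ?(ltW kap0) //; exact: weight_mono.
Qed.

Let Yterm0 N j : act j -> 0 <= lam j * kap *
      (\sum_(i < 2 * N) (1 - kap * g j) ^+ i) * dot (lI j) v ^+ 2.
Proof.
move=> Aj; rewrite mulr_ge0 ?sqr_ge0 // !mulr_ge0 ?(ltW kap0) ?(ltW (lam0 Aj)) //.
by apply: sumr_ge0 => i _; rewrite exprn_ge0.
Qed.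

Lemma penalized_value_mono N M : (N <= M)%N ->
  penalized_value N <= penalized_value M.
Proof.
move=> NM; rewrite /penalized_value lerD ?Zmono // lerD //; last first.
  apply: ler_sum => j Aj; rewrite ler_wpM2r ?sqr_ge0 // ler_wpM2l //.
    by rewrite mulr_ge0 ?(ltW kap0) ?(ltW (lam0 Aj)).
  rewrite -!(big_mkord xpredT (fun i => (1 - kap * g j) ^+ i)).
  rewrite [leRHS](big_cat_nat (n := (2 * N)%N)) ?leq_mul2l //= lerDl.
  by apply: sumr_ge0 => i _; rewrite exprn_ge0.
by rewrite lerD2l ler_wpM2r // ler_nat.
Qed.

Hypothesis v1 : \sum_a v a ^+ 2 = 1.
Hypothesis gA : forall j, act j -> g j = dot (lI j) f.
Hypothesis tangent_pos : s = 0 -> (forall a, f a = 0) ->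
  (forall i, dot (lE i) v = 0) -> (forall j, act j -> dot (lI j) v = 0) ->
  0 < qform q v.
Hypothesis feasible_pos : s = 0 -> (exists a, f a != 0) ->
  (forall i, dot (lE i) f = 0) -> (forall j, 0 <= g j) ->
  0 < \sum_(j | act j) lam j * g j + qform q f.

(** Let [X] be the factor of [N]. If X > 0, the term N X wins. If X = 0, then s = 0, f = t v, and
    [v] is tangent to the equations. For t = 0 the point is the zero itself: either [v] is tangent
    to all active inequalities, or one of their terms grows with [N]. For t <> 0 the value times t^2
    is [G] minus weights whose sum tends to 0 at feasible points and to minus infinity at infeasible
    ones. *)
Lemma penalized_value_pos : exists N, 0 < penalized_value N.
Proof.
set X := \sum_i dot (lE i) v ^+ 2 + \sum_a (f a - dot f v * v a) ^+ 2 + s ^+ 2.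
have [X_gt0|] := ltP 0 X.
  pose Z := - \sum_(j | ~~ act j) (\sum_a f a ^+ 2) * ((1 - kap * g j) ^+ (2 * 0) * g j).
  have [N hN] : exists N : nat, `|qform q v + Z| / X < N%:R.
    by exists (Num.truncn (`|qform q v + Z| / X)).+1; exact: truncnS_gt.
  exists N; rewrite /penalized_value -/X.
  have hY : 0 <= \sum_(j | act j) lam j * kap *
      (\sum_(i < 2 * N) (1 - kap * g j) ^+ i) * dot (lI j) v ^+ 2.
    by apply: sumr_ge0 => j; exact: Yterm0.
  have hZ := Zmono (leq0n N); rewrite -/Z in hZ.
  move: hN; rewrite ltr_pdivrMr // => hN.
  have := ler_norm (- (qform q v + Z)); rewrite normrN; lra.
move=> Xle0; have {Xle0} : X == 0 by rewrite eq_le Xle0.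
rewrite /X paddr_eq0 ?sqr_ge0 ?addr_ge0 ?sumr_ge0 //; try by move=> ? _; exact: sqr_ge0.
rewrite paddr_eq0 ?sumr_ge0 //; try by move=> ? _; exact: sqr_ge0.
move=> /andP[/andP[/eqP hE /eqP hF]]; rewrite sqrf_eq0 => /eqP s0.
have lE0 i : dot (lE i) v = 0.
  by apply/eqP; rewrite -sqrf_eq0; move/psumr_eq0P: hE => -> // k _; exact: sqr_ge0.
have fv a : f a = dot f v * v a.
  apply/eqP; rewrite -subr_eq0 -sqrf_eq0.
  by move/psumr_eq0P: hF => -> // k _; exact: sqr_ge0.
set t := dot f v in fv.
have [t0|t0] := eqVneq t 0.
  have f0 a : f a = 0 by rewrite fv t0 mul0r.
  have Z0 N : \sum_(j | ~~ act j) (\sum_a f a ^+ 2) * ((1 - kap * g j) ^+ (2 * N) * g j) = 0.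
    by rewrite big1 // => j _; rewrite big1 ?mul0r // => a _; rewrite f0 expr0n.
  have [|/forallPn] := boolP [forall j, act j ==> (dot (lI j) v == 0)].
    move=> /forallP lI0; exists 0%N; rewrite /penalized_value Z0 mul0r addr0 subr0.
    rewrite big1 ?addr0; last by move=> j Aj; rewrite big_ord0 mulr0 mul0r.
    apply: tangent_pos => // j Aj; apply/eqP; exact: (implyP (lI0 j)).
  move=> [j]; rewrite negb_imply => /andP[Aj lIj].
  have gj0 : g j = 0 by rewrite gA // /dot big1 // => a _; rewrite f0 mulr0.
  pose w := lam j * kap * dot (lI j) v ^+ 2.
  have w0 : 0 < w.
    apply: mulr_gt0; last by rewrite exprn_even_gt0.
    by apply: mulr_gt0 => //; exact: lam0.
  have [N hN] : exists N : nat, `|qform q v| / w < N%:R.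
    by exists (Num.truncn (`|qform q v| / w)).+1; exact: truncnS_gt.
  exists N; rewrite /penalized_value Z0 subr0 (bigD1 j) //=.
  have hY : 0 <= \sum_(i | act i && (i != j)) lam i * kap *
      (\sum_(k < 2 * N) (1 - kap * g i) ^+ k) * dot (lI i) v ^+ 2.
    by apply: sumr_ge0 => i /andP[Ai _]; exact: Yterm0.
  (* An active constraint vanishes where f = 0, so every term of the geometric sum is 1. *)
  have -> : \sum_(i < 2 * N) (1 - kap * g j) ^+ i = (2 * N)%:R.
    rewrite gj0 mulr0 subr0 (eq_bigr (fun=> 1)) => [|i _]; last by rewrite expr1n.
    by rewrite sumr_const card_ord.
  have -> : lam j * kap * (2 * N)%:R * dot (lI j) v ^+ 2 = 2 * N%:R * w.
    by rewrite /w natrM; ring.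
  move: hN; rewrite ltr_pdivrMr // => hN.
  have NX : 0 <= N%:R * X by rewrite mulr_ge0.
  have := ler_norm (- qform q v); rewrite normrN.
  have : 0 <= `|qform q v| by []; rewrite -/X; lra.
have DE : \sum_a f a ^+ 2 = t ^+ 2.
  under eq_bigr do rewrite fv exprMn.
  by rewrite -mulr_sumr v1 mulr1.
have dotf l : dot l f = t * dot l v.
  by rewrite /dot mulr_sumr; apply: eq_bigr => a _; rewrite {1}fv mulrCA.
(* An inactive constraint carries |f|^2 = t^2 and receives another t^2 from the factor on the left
   of [valE]. *)
pose m j := if act j then lam j else (t ^+ 2) ^+ 2.
have m0 j : 0 < m j.
  by rewrite /m; case: ifP => [/lam0//|_]; rewrite exprn_gt0 // exprn_even_gt0.
pose G := \sum_(j | act j) lam j * g j + qform q f.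
have valE N : t ^+ 2 * penalized_value N =
    G + N%:R * t ^+ 2 * X - \sum_j m j * ((1 - kap * g j) ^+ (2 * N) * g j).
  rewrite /penalized_value -/X /G DE !mulrDr mulrN.
  have -> : qform q f = t ^+ 2 * qform q v.
    rewrite -qformZr; apply: eq_bigr => a _; apply: eq_bigr => b _.
    by rewrite -!fv.
  rewrite [\sum_j m j * _](bigID act) /=.
  have -> : \sum_(j | ~~ act j) m j * ((1 - kap * g j) ^+ (2 * N) * g j) =
     t ^+ 2 * \sum_(j | ~~ act j) t ^+ 2 * ((1 - kap * g j) ^+ (2 * N) * g j).
    rewrite mulr_sumr; apply: eq_bigr => j /negbTE Aj.
    by rewrite /m Aj expr2 -!mulrA.
  (* With S the geometric sum, kap g^2 S = g - (1 - kap g)^(2N) g. *)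
  have -> : t ^+ 2 * (\sum_(j | act j) lam j * kap *
      (\sum_(i < 2 * N) (1 - kap * g j) ^+ i) * dot (lI j) v ^+ 2) =
    \sum_(j | act j) lam j * g j -
    \sum_(j | act j) m j * ((1 - kap * g j) ^+ (2 * N) * g j).
    rewrite mulr_sumr -sumrB; apply: eq_bigr => j Aj; rewrite /m Aj.
    set S := \sum_(i < _) _.
    have -> : (1 - kap * g j) ^+ (2 * N) = 1 - kap * g j * S.
      by rewrite /S weight_geometric subKr.
    by rewrite gA // dotf; ring.
  by ring.
suff [N hN] : exists N, 0 < G + N%:R * t ^+ 2 * X -
    \sum_j m j * ((1 - kap * g j) ^+ (2 * N) * g j).
  by exists N; move: hN; rewrite -valE pmulr_rgt0 // exprn_even_gt0.
have NX N : 0 <= N%:R * t ^+ 2 * X.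
  by apply: mulr_ge0 X0; apply: mulr_ge0 => //; exact: sqr_ge0.
have small j (e : R) : 0 < e -> \forall N \near \oo,
    m j * ((1 - kap * g j) ^+ (2 * N) * g j) <= e.
  move=> e0; have [gj|gj] := leP 0 (g j); last first.
    near=> N; apply: le_trans (ltW e0); rewrite pmulr_rle0 //.
    by rewrite mulr_ge0_le0 ?exprn_ge0 // ltW.
  have c0 : 0 < e * kap / m j by rewrite divr_gt0 ?mulr_gt0.
  apply: filterS (weight_small _ (kapg j) c0) => [N|]; last first.
    by rewrite mulr_ge0 // ltW.
  move=> h; rewrite gE; apply: le_trans (_ : m j * (kap^-1 * (e * kap / m j)) <= _).
    by rewrite !ler_pM2l ?invr_gt0.
  by rewrite le_eqVlt; apply/orP; left; apply/eqP; field; rewrite !gt_eqF.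
have smallall (e : R) : 0 < e -> \forall N \near \oo, forall j,
    m j * ((1 - kap * g j) ^+ (2 * N) * g j) <= e.
  by move=> e0; apply: filter_forall => j; exact: small.
have [gpos|[j0 gj0]] : (forall j, 0 <= g j) \/ exists j, g j < 0.
- have [/forallP|/forallPn[j]] := boolP [forall j, 0 <= g j]; first by left.
  by rewrite -ltNge; right; exists j.
- have G0 : 0 < G.
    apply: feasible_pos => // [|i]; last by rewrite dotf lE0 mulr0.
    have [|/forallPn[a va]] := boolP [forall a, v a == 0]; last first.
      by exists a; rewrite fv mulf_neq0.
    move=> /forallP v0; move: v1; rewrite big1 => [/eqP|a _].
      by rewrite eq_sym oner_eq0.
    by rewrite (eqP (v0 a)) expr0n.
  (* Each of the [#|I|] weights may use one share of [G]; the share left over keeps the total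
     positive. *)
  have e0 : 0 < G / #|I|.+1%:R by rewrite divr_gt0.
  have [N _ /(_ N (leqnn N)) hN] := smallall _ e0.
  exists N; have : \sum_j m j * ((1 - kap * g j) ^+ (2 * N) * g j) <=
      \sum_(j : I) G / #|I|.+1%:R by apply: ler_sum => j _; exact: hN.
  have -> : \sum_(j : I) G / #|I|.+1%:R = G / #|I|.+1%:R *+ #|I| by rewrite sumr_const.
  have : G / #|I|.+1%:R *+ #|I| + G / #|I|.+1%:R = G.
    by rewrite -mulrSr -[LHS]mulr_natr divfK // pnatr_eq0.
  have := NX N; move: (\sum_j m j * _) (_ *+ _) e0 => S1 S2.
  by set y := G / _; lra.
(* The violated constraint [j0] must outweigh [G] and the other weights, which are at most 1 each.
   The threshold is rescaled by [kap / m j0] because [weight_large] speaks of [kap * g j0]. *)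
have [N1 _ H1] := smallall 1 ltr01.
have kgj0 : kap * g j0 < 0 by rewrite pmulr_rlt0.
have [N2 _ H2] := weight_large (kap / m j0 * (`|G| + #|I|%:R)) kgj0.
pose N := maxn N1 N2; exists N.
have {}H1 j := H1 N (leq_maxl _ _) j; have {}H2 := H2 N (leq_maxr _ _).
have card1 : \sum_(j : I | j != j0) 1 + 1 = #|I|%:R :> R.
  have <- : \sum_(j : I) 1 = #|I|%:R :> R by rewrite sumr_const.
  by rewrite [RHS](bigD1 j0) //= addrC.
have : \sum_(j | j != j0) m j * ((1 - kap * g j) ^+ (2 * N) * g j) <=
  \sum_(j : I | j != j0) 1 by apply: ler_sum => j _; exact: H1.
have : m j0 * ((1 - kap * g j0) ^+ (2 * N) * g j0) <= - (`|G| + #|I|%:R).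
  rewrite gE -lerN2 opprK -!mulrN; apply: le_trans (_ :
    m j0 * (kap^-1 * (kap / m j0 * (`|G| + #|I|%:R))) <= _); last first.
    by rewrite !ler_pM2l ?invr_gt0 // !mulrN.
  by rewrite le_eqVlt; apply/orP; left; apply/eqP; field; rewrite !gt_eqF.
rewrite [\sum_j m j * _](bigD1 j0) //=; have := NX N.
have := ler_norm (- G); rewrite normrN; lra.
Unshelve. all: by end_near. Qed.

End PointwisePenalty.

Section OneActiveSet.
Variables (R : realType) (n r : nat) (E I : finType).
Variables (h : E -> mpoly n R) (g : I -> mpoly n R).

Definition basic_set : set 'rV[R]_n :=
  [set x | (forall i, peval (h i) x = 0) /\ (forall j, 0 <= peval (g j) x)].

(** 2 |g_j| <= 1 + g_j^2 <= [b], and Dini's argument applied to N - b bounds [b] on the cube. The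
    bound 1/2 is the range that [weight_mono] asks for. *)
Lemma cube_scaling : exists2 kap : R, 0 < kap &
  forall x j, @cube R n x -> `|kap * peval (g j) x| <= 2^-1.
Proof.
pose b : mpoly n R := 1 + \sum_j g j ^+ 2.
have [||||N HN] := @dini_positive R _ (@cube R n) (fun N x => N%:R - peval b x).
- exact: compact_cube.
- move=> N; rewrite (_ : (fun x => _) = cst N%:R \- (fun x => peval b x)) // => x.
  by apply: continuousB; [exact: cst_continuous | exact: continuous_peval].
- by move=> x N M _ NM; rewrite lerD2r ler_nat.
- move=> x _; exists (Num.truncn (peval b x)).+1.
  by rewrite subr_gt0; exact: truncnS_gt.
exists N.+1%:R^-1 => [|x j cx]; first by rewrite invr_gt0.
rewrite normrM ger0_norm ?invr_ge0 // mulrC ler_pdivrMr //.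
have := HN x cx; rewrite subr_gt0 /b pevalD peval1 peval_sum (bigD1 j) //= pevalXn.
have : 0 <= \sum_(i | i != j) peval (g i ^+ 2) x.
  by apply: sumr_ge0 => i _; rewrite pevalXn sqr_ge0.
move: (peval (g j) x) (\sum_(i | _) _) => y S S0.
rewrite -(real_normK (num_real y)) -[N.+1%:R]natr1 mulrC.
by have := sqr_ge0 (`|y| - 1); rewrite sqrrB1; lra.
Qed.

Variables (lE : E -> 'I_r -> mpoly n R) (lI : I -> 'I_r -> mpoly n R).
Variables (act : pred I) (lam : I -> R).
(* [f] is [x - z] around a zero [z], or the constant 1 when there is no zero. *)
Variables (P : 'I_r -> 'I_r -> mpoly n R) (f : 'I_r -> mpoly n R).

Section PenalizedMatrix.
Variables (kap : R) (N : nat).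
Let D := \sum_a f a ^+ 2.
Let w j : mpoly n R := 1 - mpolyC n kap * g j.

(** At a unit vector [v] its form is [penalized_value]; at v = f it is the remainder of [G] modulo
    the constraints. The entries N D on the diagonal and - N f_a f_b give N (|f|^2 |v|^2 - (f .
    v)^2), which vanishes at v = f. An inactive constraint is not expressed through [f], so it
    enters as a multiple of D times the identity, and its weight at v = f carries D^2. *)
Definition penalized_matrix (a b : 'I_r) : mpoly n R :=
  P a b
  + (N%:R * \sum_i lE i a * lE i b
  + (\sum_(j | act j) (mpolyC n (lam j * kap) * \sum_(i < 2 * N) w j ^+ i)
      * (lI j a * lI j b)
  + ((N%:R * (D + sphere_poly R n ^+ 2) - \sum_(j | ~~ act j) D * (w j ^+ (2 * N) * g j))
       * (a == b)%:R
  + (- N%:R) * (f a * f b)))).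

Lemma qform_penalized :
  (forall i, h i = \sum_a lE i a * f a) ->
  (forall j, act j -> g j = \sum_a lI j a * f a) ->
  qform penalized_matrix f =
  qform P f + N%:R * \sum_i h i ^+ 2
  + \sum_(j | act j) mpolyC n (lam j) * (g j - w j ^+ (2 * N) * g j)
  - \sum_(j | ~~ act j) D ^+ 2 * (w j ^+ (2 * N) * g j)
  + N%:R * sphere_poly R n ^+ 2 * D.
Proof.
move=> hE gE; rewrite /penalized_matrix !qformD !qformMl qform_id !qform_rank1 -/D.
rewrite qform_sum.
have -> : \sum_i qform (fun a b => lE i a * lE i b) f = \sum_i h i ^+ 2.
  by apply: eq_bigr => i _; rewrite qform_rank1 -hE.
rewrite qform_sum.
rewrite [X in _ + (_ + (X + _))](eq_bigr (fun j => mpolyC n (lam j) * (g j - w j ^+ (2 * N) * g j))).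
  have -> : \sum_(j | ~~ act j) D ^+ 2 * (w j ^+ (2 * N) * g j) =
      D * \sum_(j | ~~ act j) D * (w j ^+ (2 * N) * g j).
    by rewrite mulr_sumr; apply: eq_bigr => j _; rewrite expr2 -mulrA.
  by ring.
move=> j Aj; rewrite qformMl qform_rank1 -gE //.
have -> : w j ^+ (2 * N) = 1 - mpolyC n kap * g j * \sum_(i < 2 * N) w j ^+ i.
  have /eqP := subrX1 (w j) (2 * N); rewrite subr_eq => /eqP ->.
  by rewrite /w; ring.
by rewrite mpolyCM; ring.
Qed.

Lemma matform_penalized x v : @usphere R r v ->
  matform penalized_matrix x v =
  penalized_value (fun a b => peval (P a b) x) (fun i a => peval (lE i a) x)
    (fun j a => peval (lI j a) x) act lam (fun j => peval (g j) x)
    (fun a => peval (f a) x) (v 0) kap (peval (sphere_poly R n) x) N.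
Proof.
move=> v1; rewrite /matform /penalized_matrix.
move: (sphere_poly R n) => sp; pose pf a := peval (f a) x; pose t := \sum_a pf a * v 0 a.
have DE : peval D x = \sum_a pf a ^+ 2.
  by rewrite peval_sum; apply: eq_bigr => a _; rewrite pevalXn.
have wE j : peval (w j) x = 1 - kap * peval (g j) x by rewrite !pevalE.
have peval_nat (k : nat) : peval k%:R x = k%:R by exact: rmorph_nat.
have dist : \sum_a (pf a - t * v 0 a) ^+ 2 = peval D x - t ^+ 2.
  rewrite DE; transitivity (\sum_a (pf a ^+ 2 - 2 * t * (pf a * v 0 a) + t ^+ 2 * v 0 a ^+ 2)).
    by apply: eq_bigr => a _; ring.
  rewrite big_split sumrB /= -!mulr_sumr -/t v1; ring.
rewrite /penalized_value -/pf -/t dist.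
rewrite (@eq_qform _ _ _ (fun a b => peval (P a b) x
  + (N%:R * (\sum_i peval (lE i a) x * peval (lE i b) x)
  + (\sum_(j | act j) (lam j * kap * \sum_(i < 2 * N) (1 - kap * peval (g j) x) ^+ i)
      * (peval (lI j a) x * peval (lI j b) x)
  + ((N%:R * (peval D x + peval sp x ^+ 2)
      - \sum_(j | ~~ act j) peval D x * ((1 - kap * peval (g j) x) ^+ (2 * N) * peval (g j) x))
       * (a == b)%:R
  + (- N%:R) * (pf a * pf b)))))); last first.
  move=> a b; rewrite !pevalD !pevalM !pevalN !pevalB !peval_nat.
  rewrite !pevalM !pevalD !pevalXn !peval_sum !peval_nat.
  congr (_ + (_ * _ + (_ + ((_ - _) * _ + _)))).
  - by apply: eq_bigr => i _; rewrite pevalM.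
  - apply: eq_bigr => j _; rewrite !pevalM pevalC peval_sum; congr (_ * _ * _).
    by apply: eq_bigr => i _; rewrite pevalXn wE.
  - by apply: eq_bigr => j _; rewrite !pevalM pevalXn wE peval_sum.
rewrite !qformD !qformMl qform_id !qform_rank1 v1 -/t !qform_sum -DE.
have -> : \sum_i qform (fun a b => peval (lE i a) x * peval (lE i b) x) (v 0) =
    \sum_i (\sum_a peval (lE i a) x * v 0 a) ^+ 2.
  by apply: eq_bigr => i _; rewrite qform_rank1.
rewrite [X in _ + (_ + (X + _))](eq_bigr (fun j => lam j * kap *
  (\sum_(i < 2 * N) (1 - kap * peval (g j) x) ^+ i) * (\sum_a peval (lI j a) x * v 0 a) ^+ 2)).
  by ring.
by move=> j _; rewrite qformMl qform_rank1.
Qed.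

End PenalizedMatrix.
(** Positivity is assumed only on the basic set and on tangent directions; [penalized_value_pos] and
    Dini's argument extend it to the cube times the unit sphere, as [matrix_positivstellensatz]
    requires. *)
Theorem ideal_qm_one_active_set (e0 : E) (lamE : E -> R) (G : mpoly n R) :
  h e0 = sphere_poly R n ->
  (forall a b, P a b = P b a) ->
  (forall i, h i = \sum_a lE i a * f a) ->
  (forall j, act j -> g j = \sum_a lI j a * f a) ->
  (forall j, act j -> 0 < lam j) ->
  G = \sum_i mpolyC n (lamE i) * h i + \sum_(j | act j) mpolyC n (lam j) * g j
      + qform P f ->
  (forall x v, @usphere R r v -> (forall a, peval (f a) x = 0) ->
     (forall i, \sum_a peval (lE i a) x * v 0 a = 0) ->
     (forall j, act j -> \sum_a peval (lI j a) x * v 0 a = 0) ->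
     0 < matform P x v) ->
  (forall x, basic_set x -> (exists a, peval (f a) x != 0) -> 0 < peval G x) ->
  ideal_qm h g G.
Proof.
move=> he0 Psym hE gE lam0 GE tan pos.
have [kap kap0 kapg] := cube_scaling.
have [|||N HN] := @dini_positive R _ _
  (fun N (xv : 'rV[R]_n * 'rV[R]_r) => matform (penalized_matrix kap N) xv.1 xv.2)
  (compact_cube_usphere (r := r)).
- by move=> N; exact: continuous_matform.
- move=> [x v] N M [/= cx sv] NM; rewrite !matform_penalized //.
  by apply: penalized_value_mono => // j; exact: kapg.
- move=> [x v] [/= cx sv].
  have [|||||||N vN] := @penalized_value_pos R r E I (fun a b => peval (P a b) x)
    (fun i a => peval (lE i a) x) (fun j a => peval (lI j a) x) act lam
    (fun j => peval (g j) x) (fun a => peval (f a) x) (v 0) kap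
    (peval (sphere_poly R n) x).
  + exact: kap0.
  + by move=> j; exact: kapg.
  + exact: lam0.
  + exact: sv.
  + by move=> j Aj; rewrite {1}gE // peval_sum; apply: eq_bigr => a _; rewrite pevalM.
  + by move=> _ f0 lE0 lI0; apply: tan.
  + move=> _ fN0 lE0 gpos.
    have hx0 i : peval (h i) x = 0.
      by rewrite hE peval_sum -[RHS](lE0 i); apply: eq_bigr => a _; rewrite pevalM.
    suff -> : \sum_(j | act j) lam j * peval (g j) x +
        qform (fun a b => peval (P a b) x) (fun a => peval (f a) x) = peval G x.
      exact: pos.
    rewrite GE !pevalD peval_qform !peval_sum [X in _ = X + _ + _]big1 => [|i _].
      by rewrite add0r; congr (_ + _); apply: eq_bigr => j _; rewrite pevalM pevalC.
    by rewrite pevalM hx0 mulr0.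
  by exists N; rewrite matform_penalized.
have PMsym a b : penalized_matrix kap N a b = penalized_matrix kap N b a.
  rewrite /penalized_matrix Psym [f b * _]mulrC [b == a]eq_sym; congr (_ + (_ * _ + (_ + _))).
    by apply: eq_bigr => i _; rewrite mulrC.
  by apply: eq_bigr => j _; rewrite [lI j b * _]mulrC.
have : ideal_qm h g (qform (penalized_matrix kap N) f).
  apply: ideal_qm_sos_sphere he0 _; apply: matrix_positivstellensatz => // x v cx sv.
  exact: (HN (x, v)).
rewrite qform_penalized //; set D := \sum_a f a ^+ 2; pose w j := 1 - mpolyC n kap * g j.
set Q := (X in ideal_qm h g X) => idQ.
(* What was subtracted from [G], sorted by origin: multiples of the equations, active and inactive
   inequalities times sums of squares (the exponents 2N are even), and the penalty on the sphere
   equation. *)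
have -> : G = Q + \sum_i h i * (mpolyC n (lamE i) - N%:R * h i)
   + \sum_(j | act j) g j * (mpolyC n (lam j) * w j ^+ (2 * N))
   + \sum_(j | ~~ act j) g j * (D * w j ^+ N) ^+ 2
   + h e0 * (- N%:R * sphere_poly R n * D).
  have -> : \sum_i h i * (mpolyC n (lamE i) - N%:R * h i) =
      \sum_i mpolyC n (lamE i) * h i - N%:R * \sum_i h i ^+ 2.
    by rewrite mulr_sumr -sumrB; apply: eq_bigr => i _; ring.
  have -> : \sum_(j | act j) g j * (mpolyC n (lam j) * w j ^+ (2 * N)) =
      \sum_(j | act j) mpolyC n (lam j) * g j -
      \sum_(j | act j) mpolyC n (lam j) * (g j - w j ^+ (2 * N) * g j).
    by rewrite -sumrB; apply: eq_bigr => j _; ring.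
  have -> : \sum_(j | ~~ act j) g j * (D * w j ^+ N) ^+ 2 =
      \sum_(j | ~~ act j) D ^+ 2 * (w j ^+ (2 * N) * g j).
    by apply: eq_bigr => j _; rewrite exprMn -exprM [(N * 2)%N]mulnC; ring.
  by rewrite GE /Q he0; ring.
apply: ideal_qmD; last exact: ideal_qm_eq.
have sos_even (p : mpoly n R) : sos (p ^+ (2 * N)).
  by rewrite mulnC exprM; exact: sos_sqr.
apply: ideal_qmD; last by apply: ideal_qm_sum => j _; apply: ideal_qm_ineq; exact: sos_sqr.
apply: ideal_qmD; last first.
  apply: ideal_qm_sum => j /lam0 /ltW lj; apply: ideal_qm_ineq.
  by apply: sosM => //; exact: sos_const.
by apply: ideal_qmD => //; apply: ideal_qm_sum => i _; exact: ideal_qm_eq.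
Qed.

End OneActiveSet.

(** * Polynomial partitions of unity *)

Section PartitionOfUnity.
Variables (R : realType) (n : nat).
Implicit Types (z : 'rV[R]_n) (Z : seq 'rV[R]_n).

Definition sqdist z : mpoly n R := \sum_a centered z a ^+ 2.

Lemma peval_sqdist z x : peval (sqdist z) x = \sum_a (x 0 a - z 0 a) ^+ 2.
Proof.
by rewrite peval_sum; apply: eq_bigr => a _; rewrite pevalXn peval_centered.
Qed.

Lemma sqdist_ge0 z x : 0 <= peval (sqdist z) x.
Proof. by rewrite peval_sqdist sumr_ge0 // => a _; exact: sqr_ge0. Qed.

Lemma sqdist_gt0 z x : x != z -> 0 < peval (sqdist z) x.
Proof.
move=> xz; rewrite lt0r sqdist_ge0 andbT; apply: contra xz => /eqP.
rewrite peval_sqdist => /psumr_eq0P h; apply/eqP/rowP => a; apply/eqP.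
by rewrite -subr_eq0 -sqrf_eq0 h // => b _; exact: sqr_ge0.
Qed.

(** 1 - (1 - kap |x - z|^2)^N vanishes at [z] and lies between 0 and 1 on the cube; it is divided by
    its value [c] at [z']. Taking c > 2/3 bounds the quotient by 3/2, which makes 3 - 2 u positive
    in the partition of unity. *)
Lemma separating_poly z z' : z' != z -> @cube R n z' -> exists u : mpoly n R,
  [/\ peval u z = 0, peval u z' = 1
    & forall x, @cube R n x -> 0 <= peval u x < 3 / 2].
Proof.
move=> zz' cz'.
have [kap kap0 kapD] := @cube_scaling R n unit (fun=> sqdist z).
have range x : @cube R n x -> 2^-1 <= 1 - kap * peval (sqdist z) x <= 1.
  move=> cx; have := kapD x tt cx; have := sqdist_ge0 z x => D0.
  have : 0 <= kap * peval (sqdist z) x by rewrite mulr_ge0 // ltW.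
  by rewrite ler_norml => + /andP[_]; move: (kap * _) => y; lra.
pose y := 1 - kap * peval (sqdist z) z'.
have y1 : `|y| < 1.
  have /andP[y0 _] := range z' cz'; rewrite ger0_norm; last by rewrite /y; lra.
  by rewrite /y gtrBl mulr_gt0 // sqdist_gt0.
have [N yN] : exists N, `|y ^+ N| < 3^-1.
  have /cvgr0Pnorm_lt/(_ 3^-1)[] := cvg_expr y1; first by rewrite invr_gt0.
  by move=> N _ /(_ N) h; exists N; apply: h => /=.
pose c := 1 - y ^+ N.
have c0 : 2 / 3 < c by move: yN; rewrite ltr_norml /c => /andP[_]; lra.
exists (mpolyC n c^-1 * (1 - (1 - mpolyC n kap * sqdist z) ^+ N)).
have uE x : peval (mpolyC n c^-1 * (1 - (1 - mpolyC n kap * sqdist z) ^+ N)) x =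
    c^-1 * (1 - (1 - kap * peval (sqdist z) x) ^+ N).
  by rewrite pevalM pevalC pevalB pevalXn pevalB pevalM pevalC !peval1.
split=> [||x cx]; rewrite uE.
- rewrite peval_sqdist big1 => [|a _]; last by rewrite subrr expr0n.
  by rewrite mulr0 subr0 expr1n subrr mulr0.
- by rewrite -/y mulVf // gt_eqF //; lra.
have /andP[r0 r1] := range x cx; have cp : 0 < c by lra.
have r00 : 0 <= 1 - kap * peval (sqdist z) x by lra.
have e0 := exprn_ge0 N r00; have e1 := exprn_ile1 N r00 r1.
apply/andP; split; first by apply: mulr_ge0; [rewrite invr_ge0 ltW | rewrite subr_ge0].
by rewrite mulrC ltr_pdivrMr //; lra.
Qed.

(** Points are added one at a time, each triple being split by a polynomial that separates its point
    from the new one; several triples may thus carry the same point. The first factor enters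
    squared, so that multiplication by it preserves the cone, while the second one is only positive
    and must be absorbed into the certificate. *)
Lemma polynomial_partition_of_unity Z : uniq Z -> Z != [::] ->
  (forall z, z \in Z -> @cube R n z) ->
  exists L : seq (mpoly n R * mpoly n R * 'rV[R]_n),
  \sum_(t <- L) t.1.1 ^+ 2 * t.1.2 = 1 /\
  forall t, t \in L -> [/\ t.2 \in Z,
    forall x, @cube R n x -> 0 < peval t.1.2 x
    & forall z, z \in Z -> z != t.2 -> peval t.1.1 z = 0].
Proof.
elim: Z => [//|z Z IH] /= /andP[zZ uZ] _ Zc.
have [Z0|Z0] := eqVneq Z [::].
  exists [:: (1, 1, z)]; rewrite big_seq1 expr1n mul1r; split=> // t.
  rewrite inE => /eqP->/=; split; rewrite ?inE ?eqxx //.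
    by move=> x _; rewrite peval1.
  by move=> z'; rewrite Z0 inE => /eqP->; rewrite eqxx.
have [|L [L1 LP]] := IH uZ Z0; first by move=> z' zZ'; apply: Zc; rewrite inE zZ' orbT.
have [u uP] : exists u : 'rV[R]_n -> mpoly n R, forall z', z' \in Z ->
    [/\ peval (u z') z = 0, peval (u z') z' = 1
    & forall x, @cube R n x -> 0 <= peval (u z') x < 3 / 2].
  suff /choice[u uP] : forall z', exists u : mpoly n R, z' \in Z ->
      [/\ peval u z = 0, peval u z' = 1
      & forall x, @cube R n x -> 0 <= peval u x < 3 / 2] by exists u.
  move=> z'; have [zZ'|_] := boolP (z' \in Z); last by exists 0.
  have [||u uP] := @separating_poly z z'; last by exists u.
    by apply: contraNneq zZ => <-.
  by apply: Zc; rewrite inE zZ' orbT.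
(* [u^2 (3 - 2 u) + (1 - u)^2 (1 + 2 u) = 1] *)
exists ([seq (t.1.1 * u t.2, t.1.2 * (3 - 2 * u t.2), t.2) | t <- L] ++
        [seq (t.1.1 * (1 - u t.2), t.1.2 * (1 + 2 * u t.2), z) | t <- L]).
split.
  rewrite big_cat !big_map /= -big_split -[RHS]L1; apply: eq_bigr => t _ /=; ring.
have pE k x : peval (k%:R : mpoly n R) x = k%:R by exact: rmorph_nat.
move=> t; rewrite mem_cat => /orP[] /mapP[t' /LP[tZ bpos s0] ->] /=.
  have [uz ut urange] := uP _ tZ; split; first by rewrite inE tZ orbT.
    move=> x cx; rewrite pevalM mulr_gt0 ?bpos // pevalB pevalM !pE.
    by have := urange x cx; lra.
  move=> z'; rewrite inE => /orP[/eqP-> _|zZ' zt]; first by rewrite pevalM uz mulr0.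
  by rewrite pevalM s0 // mul0r.
have [uz ut urange] := uP _ tZ; split; first by rewrite inE eqxx.
  move=> x cx; rewrite pevalM mulr_gt0 ?bpos // pevalD pevalM peval1 pE.
  by have := urange x cx; lra.
move=> z'; rewrite inE => /orP[/eqP->|zZ' _]; first by rewrite eqxx.
rewrite pevalM pevalB peval1; have [->|zt] := eqVneq z' t'.2; last by rewrite s0 // mul0r.
by rewrite ut subrr mulr0.
Qed.

End PartitionOfUnity.

(** * Isolated zeros and local certificates *)

(** Compactness is used along the filter of finite lists ordered by inclusion: near [x] the only
    point of [K] is [x], and it belongs to every list from some list on, so one list catches all of
    [K]. *)
Lemma compact_isolated_finite (T : topologicalType) (K : set T) :
  compact K -> (forall x, K x -> \forall x' \near x, K x' -> x' = x) ->
  exists s : seq T, uniq s /\ forall x, K x <-> x \in s.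
Proof.
move=> /compact_near_coveringP ncK iso.
pose F : set_system (seq T) := fun A => exists s0 : seq T,
  forall s, {subset s0 <= s} -> A s.
have FF : Filter F.
  split; first by exists [::].
    move=> A B [s As] [t Bt]; exists (s ++ t) => u stu.
    by split; [apply: As | apply: Bt] => x xs; apply: stu; rewrite mem_cat xs ?orbT.
  by move=> A B AB [s As]; exists s => t st; apply: AB; exact: As.
have [x Kx|s sK] := ncK _ F (fun s x => K x -> x \in s) FF.
  exists ([set x' | K x' -> x' = x], [set s : seq T | x \in s]).
    by split; [exact: iso | exists [:: x] => s; apply; rewrite inE].
  by move=> [x' s] /= [h xs] /h ->.
have {}sK x : K x -> x \in s by move=> Kx; exact: (sK s (fun _ h => h) x Kx Kx).
exists (undup [seq x <- s | `[< K x >]]); split; first exact: undup_uniq.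
move=> x; rewrite mem_undup mem_filter; split=> [Kx|/andP[/asboolP]//].
by rewrite sK // andbT; apply/asboolP.
Qed.

Lemma near_all_seq (T : eqType) (s : seq T) (Q : T -> nat -> Prop) :
  (forall x, x \in s -> \forall N \near \oo, Q x N) ->
  \forall N \near \oo, forall x, x \in s -> Q x N.
Proof.
elim: s => [_|y s IH QN]; first by apply: nearW => N x; rewrite in_nil.
have H1 := QN y (mem_head _ _).
have H2 := IH (fun x xs => QN x (mem_behead (s := y :: s) xs)).
near=> N => x; rewrite inE => /orP[/eqP->|xs]; first by near: N.
by move: x xs; near: N.
Unshelve. all: by end_near. Qed.

Section LocalCertificates.
Variables (R : realType) (n : nat) (E I : finType).
Variables (h : E -> mpoly n R) (g : I -> mpoly n R).
Implicit Types (G : mpoly n R) (z x : 'rV[R]_n).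

Let K := basic_set h g.

(* The algebraic form of LICQC (through [lE], [lI], the linear parts of the
   active constraints), SCC ([lam] positive) and SOSC (the last clause). *)
Definition local_certificate G z : Prop :=
  exists (P : 'I_n -> 'I_n -> mpoly n R) (lE : E -> 'I_n -> mpoly n R)
    (lI : I -> 'I_n -> mpoly n R) (lamE : E -> R) (lam : I -> R),
  let act j := peval (g j) z == 0 in
  [/\ forall a b, P a b = P b a,
      forall i, h i = \sum_a lE i a * centered z a,
      forall j, act j -> g j = \sum_a lI j a * centered z a,
      (forall j, act j -> 0 < lam j) /\
      G = \sum_i mpolyC n (lamE i) * h i + \sum_(j | act j) mpolyC n (lam j) * g j
          + qform P (centered z)
    & forall v, @usphere R n v ->
        (forall i, \sum_a peval (lE i a) z * v 0 a = 0) ->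
        (forall j, act j -> \sum_a peval (lI j a) z * v 0 a = 0) ->
        0 < matform P z v].

Section TangentPositivity.
Variables (z : 'rV[R]_n) (act : pred I).
Variables (lE : E -> 'I_n -> mpoly n R) (lI : I -> 'I_n -> mpoly n R).
Variables (P W : 'I_n -> 'I_n -> mpoly n R).

Definition augmented_matrix (N : R) a b : mpoly n R :=
  P a b + mpolyC n N * (\sum_i lE i a * lE i b + \sum_(j | act j) lI j a * lI j b).

Lemma qform_augmented (N : R) (v : 'I_n -> mpoly n R) :
  qform (augmented_matrix N) v = qform P v + mpolyC n N *
    (\sum_i (\sum_a lE i a * v a) ^+ 2 + \sum_(j | act j) (\sum_a lI j a * v a) ^+ 2).
Proof.
rewrite qformD qformMl qformD !qform_sum.
by congr (_ + _ * (_ + _)); apply: eq_bigr => i _; rewrite qform_rank1.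
Qed.

Lemma matform_augmented (N : R) x (v : 'rV[R]_n) :
  matform (augmented_matrix N) x v = matform P x v + N *
    (\sum_i (\sum_a peval (lE i a) x * v 0 a) ^+ 2 +
     \sum_(j | act j) (\sum_a peval (lI j a) x * v 0 a) ^+ 2).
Proof.
rewrite /matform (@eq_qform _ _ _ (fun a b => peval (P a b) x + N *
   (\sum_i peval (lE i a) x * peval (lE i b) x
    + \sum_(j | act j) peval (lI j a) x * peval (lI j b) x))).
  rewrite qformD qformMl qformD !qform_sum.
  by congr (_ + _ * (_ + _)); apply: eq_bigr => i _;
    rewrite (qform_rank1 (fun a => peval _ x)).
move=> a b; rewrite pevalD pevalM pevalC pevalD !peval_sum.
by congr (_ + _ * (_ + _)); apply: eq_bigr => i _; rewrite pevalM.
Qed.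

Hypothesis W0 : forall v, 0 <= matform W z v.
Hypothesis tangent_pos : forall v, @usphere R n v ->
  (forall i, \sum_a peval (lE i a) z * v 0 a = 0) ->
  (forall j, act j -> \sum_a peval (lI j a) z * v 0 a = 0) ->
  0 < matform P z v.

(** Finsler's lemma with a slack: a form that is positive on the tangent space becomes positive
    definite once large multiples of the squared linear constraints are added. The slack W / (N + 1)
    leaves room for [local_certificate_sub]. *)
Lemma augmented_pos : exists N, forall v, @usphere R n v ->
  0 < matform (augmented_matrix N%:R) z v - N.+1%:R^-1 * matform W z v.
Proof.
pose X (v : 'rV[R]_n) := \sum_i (\sum_a peval (lE i a) z * v 0 a) ^+ 2 +
     \sum_(j | act j) (\sum_a peval (lI j a) z * v 0 a) ^+ 2.
have X0 v : 0 <= X v by rewrite addr_ge0 // sumr_ge0 // => i _; exact: sqr_ge0.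
apply: dini_positive; first exact: compact_usphere.
- move=> N.
  have cz (Q : 'I_n -> 'I_n -> mpoly n R) : continuous (matform Q z).
    apply: continuous_sumr => a; apply: continuous_sumr => b v.
    exact: continuousM (@cst_continuous _ _ (peval (Q a b) z) v)
      (continuousM (@continuous_coord R n a v) (@continuous_coord R n b v)).
  rewrite (_ : (fun v => _) = matform (augmented_matrix N%:R) z \-
    (cst (N.+1%:R^-1) \* matform W z)) // => v.
  apply: continuousB; first exact: cz.
  by apply: continuousM; [exact: cst_continuous | exact: cz].
- move=> v N M _ NM; rewrite !matform_augmented -/(X v).
  rewrite lerD ?lerD2l ?ler_wpM2r ?ler_nat // lerN2 ler_wpM2r //.
  by rewrite lef_pV2 ?posrE ?ler_nat.
move=> v sv; have [Xv|] := ltP 0 (X v).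
  have [N hN] : exists N : nat, (`|matform P z v| + matform W z v) / X v < N%:R.
    by exists (Num.truncn ((`|matform P z v| + matform W z v) / X v)).+1; exact: truncnS_gt.
  exists N; rewrite matform_augmented -/(X v); move: hN; rewrite ltr_pdivrMr // => hN.
  have := ler_norm (- matform P z v); rewrite normrN.
  have : N.+1%:R^-1 * matform W z v <= matform W z v.
    by rewrite ler_piMl // invf_le1 // ler1n.
  by move: hN; move: (_ * matform W z v) (N%:R * X v) (matform P z v) => c d p; lra.
move=> Xle0; have {Xle0} : X v == 0 by rewrite eq_le Xle0 X0.
rewrite paddr_eq0 ?sumr_ge0 //; try by move=> ? _; exact: sqr_ge0.
move=> /andP[/eqP hE /eqP hI].
have Pv : 0 < matform P z v.
  apply: tangent_pos => // [i|j Aj]; apply/eqP; rewrite -sqrf_eq0.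
    by move/psumr_eq0P: hE => -> // k _; exact: sqr_ge0.
  by move/psumr_eq0P: hI => -> // k _; exact: sqr_ge0.
exists (Num.truncn (matform W z v / matform P z v)).
rewrite matform_augmented -/(X v); have := X0 v => Xv.
set N := Num.truncn _.
have : matform W z v / matform P z v < N.+1%:R by exact: truncnS_gt.
rewrite ltr_pdivrMr // => hN.
have : N.+1%:R^-1 * matform W z v < matform P z v by rewrite mulrC ltr_pdivrMr // mulrC.
have : 0 <= N%:R * X v by rewrite mulr_ge0.
by move: (_ * matform W z v) (N%:R * X v) (matform P z v) => c d p; lra.
Qed.

End TangentPositivity.
(** The unit sphere is compact, so one neighborhood of [z] serves all directions. *)
Lemma near_matform_pos (Q : 'I_n -> 'I_n -> mpoly n R) z :
  (forall v, @usphere R n v -> 0 < matform Q z v) ->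
  \forall x \near z, forall v, @usphere R n v -> 0 < matform Q x v.
Proof.
move=> Qz; have /compact_near_coveringP/near_covering_withinP ncS := @compact_usphere R n.
have : \forall x \near z, @usphere R n `<=` (fun v => 0 < matform Q x v).
  apply: (ncS _ (nbhs z) (fun x v => 0 < matform Q x v) _) => v sv; have Qzv := Qz v sv.
  have [[A B] [/= nA nB] AB] : nbhs (z, v) [set xv | 0 < matform Q xv.1 xv.2].
    exact: (cvgr_gt _ (@continuous_matform R n n Q (z, v)) _ Qzv).
  by exists (B, A) => // -[v' x] /= [Bv Ax] _; exact: (AB (x, v')).
by apply: filterS => x Qx v; exact: Qx.
Qed.

(** On [K] near [z] the active constraints satisfy N g_j < lam_j, hence lam_j g_j >= N g_j^2. The
    multiplier terms thus dominate the squares added by [augmented_matrix], and [G] is at least a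
    positive definite form in x - z. Strict positivity of [lam] provides the neighborhood. *)
Lemma local_certificate_isolated G z : K z -> local_certificate G z ->
  \forall x \near z, K x -> x != z -> 0 < peval G x.
Proof.
move=> [hz gz] [P [lE [lI [lamE [lam [Psym hE gE [lam0 GE] tan]]]]]].
have W0 (v : 'rV[R]_n) : 0 <= matform (fun _ _ => 0 : mpoly n R) z v.
  rewrite /matform /qform big1 // => a _; rewrite big1 // => b _.
  by rewrite peval0 mul0r.
have [N HN] := augmented_pos W0 tan.
set act := fun j => peval (g j) z == 0 in gE lam0 GE tan HN.
have {}HN v : usphere v -> 0 < matform (augmented_matrix act lE lI P N%:R) z v.
  move=> sv; have := HN v sv.
  have -> : matform (fun _ _ => 0 : mpoly n R) z v = 0.
    rewrite /matform /qform big1 // => a _; rewrite big1 // => b _.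
    by rewrite peval0 mul0r.
  by rewrite mulr0 subr0.
have nearQ := near_matform_pos HN.
have nearg : \forall x \near z, forall j, act j -> N%:R * peval (g j) x < lam j.
  apply: (@filter_forall _ _ _ (nbhs z) _) => j.
  have [Aj|_] := boolP (act j); last exact: nearW.
  suff : \forall x \near z, peval (mpolyC n N%:R * g j) x < lam j.
    by apply: filterS => x; rewrite pevalM pevalC.
  have zj : peval (mpolyC n N%:R * g j) z < lam j by rewrite pevalM (eqP Aj) mulr0 lam0.
  exact: (cvgr_lt _ (@continuous_peval R n _ z) _ zj).
near=> x => -[hx gx] xz.
have Qx : forall v, @usphere R n v -> 0 < matform (augmented_matrix act lE lI P N%:R) x v.
  by near: x.
have gxl : forall j, act j -> N%:R * peval (g j) x < lam j by near: x.
have : 0 < peval (qform (augmented_matrix act lE lI P N%:R) (centered z)) x.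
  rewrite peval_qform; apply: (qform_pos_usphere Qx).
  have [|/forallPn[a xa]] := boolP [forall a, x 0 a - z 0 a == 0]; last first.
    by exists a; rewrite peval_centered.
  move=> /forallP xz0; case/eqP: xz; apply/rowP => a.
  by apply/eqP; rewrite -subr_eq0 xz0.
have GxE : peval G x = \sum_(j | act j) lam j * peval (g j) x + peval (qform P (centered z)) x.
  rewrite GE !pevalD; congr (_ + _); rewrite !peval_sum [X in X + _]big1 => [|i _].
    by rewrite add0r; apply: eq_bigr => j _; rewrite pevalM pevalC.
  by rewrite pevalM hx mulr0.
have -> : peval (qform (augmented_matrix act lE lI P N%:R) (centered z)) x =
    peval (qform P (centered z)) x + N%:R * \sum_(j | act j) peval (g j) x ^+ 2.
  rewrite qform_augmented pevalD pevalM pevalC pevalD; congr (_ + _ * _).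
  rewrite !peval_sum [X in X + _]big1 => [|i _]; last by rewrite pevalXn -hE hx expr0n.
  by rewrite add0r; apply: eq_bigr => j Aj; rewrite pevalXn -gE.
rewrite GxE => /lt_le_trans; apply.
rewrite addrC lerD2r mulr_sumr; apply: ler_sum => j Aj.
by rewrite expr2 mulrA ler_wpM2r // ltW // gxl.
Unshelve. all: by end_near. Qed.

Lemma local_certificate_sub G z (Wm : 'I_n -> 'I_n -> mpoly n R) :
  local_certificate G z -> (forall a b, Wm a b = Wm b a) ->
  (forall v, 0 <= matform Wm z v) ->
  \forall N \near \oo,
    local_certificate (G - mpolyC n N.+1%:R^-1 * qform Wm (centered z)) z.
Proof.
move=> [P [lE [lI [lamE [lam [Psym hE gE [lam0 GE] tan]]]]]] Wsym W0.
have [N0 HN] := augmented_pos W0 tan.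
exists N0 => // N /= N0N.
exists (fun a b => P a b + (- mpolyC n N.+1%:R^-1) * Wm a b), lE, lI, lamE, lam.
split=> //.
- by move=> a b; rewrite Psym Wsym.
- split=> //; rewrite qformD qformMl mulNr {1}GE; ring.
move=> v sv vE vI; have := HN v sv; rewrite matform_augmented.
rewrite big1 => [|i _]; last by rewrite vE expr0n.
rewrite big1 => [|j Aj]; last by rewrite vI // expr0n.
rewrite addr0 mulr0 addr0 => Pv.
have -> : matform (fun a b => P a b + - mpolyC n N.+1%:R^-1 * Wm a b) z v =
    matform P z v - N.+1%:R^-1 * matform Wm z v.
  rewrite /matform -mulNr -qformMl -qformD; apply: eq_qform => a b.
  by rewrite pevalD pevalM pevalN pevalC.
apply: lt_le_trans Pv _; rewrite lerD2l lerN2 ler_wpM2r //.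
by rewrite lef_pV2 ?posrE ?ler_nat.
Qed.

End LocalCertificates.

(** * From local certificates to membership *)

Section LocalToGlobal.
Variables (R : realType) (n : nat) (E I : finType).
Variables (h : E -> mpoly n R) (g : I -> mpoly n R) (e0 : E).
Hypothesis he0 : h e0 = sphere_poly R n.
Implicit Types (G : mpoly n R) (z x : 'rV[R]_n).

Let K := basic_set h g.

Lemma basic_set_cube : K `<=` @cube R n.
Proof.
move=> x [hx _]; apply: usphere_cube; rewrite /usphere /=.
have := hx e0; rewrite he0 pevalB peval1 peval_sum => /eqP.
by rewrite subr_eq0 => /eqP <-; apply: eq_bigr => i _; rewrite pevalXn pevalX.
Qed.

Lemma closed_basic_set : closed K.
Proof.
rewrite (_ : K = (\bigcap_i [set x | peval (h i) x = 0]) `&`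
                 (\bigcap_j [set x | - peval (g j) x <= 0])).
  apply: closedI; apply: closed_bigI => i _.
    by apply: closed_eq_continuous; exact: continuous_peval.
  apply: closed_le_continuous => x; apply: continuousN; exact: continuous_peval.
apply/seteqP; split=> x [hx gx]; split=> i //=.
- by move=> _; rewrite oppr_le0.
- exact: hx i Logic.I.
- by have := gx i Logic.I; rewrite /= oppr_le0.
Qed.

Lemma compact_basic_set : compact K.
Proof. exact: subclosed_compact closed_basic_set (@compact_cube R n) basic_set_cube. Qed.

Lemma zeros_finite G : (forall z, K z -> peval G z = 0 -> local_certificate h g G z) ->
  exists Z : seq 'rV[R]_n, uniq Z /\ forall z, K z /\ peval G z = 0 <-> z \in Z.
Proof.
move=> cert; apply: (@compact_isolated_finite _ [set z | K z /\ peval G z = 0]).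
  apply: (compact_closedI compact_basic_set).
  by apply: closed_eq_continuous; exact: continuous_peval.
move=> z [Kz Gz]; apply: filterS (local_certificate_isolated Kz (cert z Kz Gz)).
move=> x Gx [Kx Gx0]; apply/eqP/negPn/negP => xz.
by have := Gx Kx xz; rewrite Gx0 ltxx.
Qed.

(** Putinar's Positivstellensatz: with r = 1 and f = 1 there is no zero to factor out, every
    inequality counts as inactive, and the matrix is [G] itself. *)
Lemma ideal_qm_positive G : (forall x, K x -> 0 < peval G x) -> ideal_qm h g G.
Proof.
move=> Gpos.
apply: (@ideal_qm_one_active_set R n 1 E I h g (fun i _ => h i) (fun _ _ => 0)
  pred0 (fun=> 1) (fun _ _ => G) (fun=> 1) e0 (fun=> 0)) => //.
- by move=> i; rewrite big_ord1 mulr1.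
- rewrite [X in X + _ + _]big1 => [|i _]; last by rewrite mpolyC0 mul0r.
  by rewrite /qform [X in _ + X + _]big1 // !big_ord1 !mulr1 !add0r.
- by move=> x v _ /(_ ord0); rewrite peval1 => /eqP; rewrite oner_eq0.
- by move=> x Kx _; exact: Gpos.
Qed.

(* [b * G + d |x - z|^2] vanishes on [K] at most at [z], where it inherits the
   certificate of [G] with multipliers [b z * lam]: the error [(b - b z) lam c]
   is a product of two functions vanishing at [z], and its quadratic part is
   zero on the tangent directions. *)
Lemma ideal_qm_single_zero G (b : mpoly n R) (d : R) z :
  K z -> local_certificate h g G z -> 0 < d ->
  (forall x, @cube R n x -> 0 < peval b x) ->
  (forall x, K x -> 0 <= peval G x) ->
  ideal_qm h g (b * G + mpolyC n d * sqdist z).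
Proof.
move=> Kz [P [lE [lI [lamE [lam [Psym hE gE [lam0 GE] tan]]]]]] d0 bpos G0.
set act := fun j => peval (g j) z == 0 in gE lam0 GE tan.
have bz0 : 0 < peval b z by apply: bpos; exact: basic_set_cube.
have [m bE] := hadamard z b.
(* The symmetric matrix of a product of two linear forms. With [m] the cofactors of b - b(z), it
   represents (b - b(z)) h_i and (b - b(z)) g_j as forms in x - z. *)
pose sym (u w : 'I_n -> mpoly n R) a c := mpolyC n 2^-1 * (u a * w c + w a * u c).
have sym_form u w (v : 'I_n -> mpoly n R) :
    qform (sym u w) v = (\sum_a u a * v a) * (\sum_a w a * v a).
  have cross (u' w' : 'I_n -> mpoly n R) : qform (fun a c => u' a * w' c) v =
      (\sum_a u' a * v a) * (\sum_a w' a * v a).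
    rewrite mulr_suml; apply: eq_bigr => a _; rewrite mulr_sumr.
    by apply: eq_bigr => c _; rewrite mulrACA.
  have half2 : mpolyC n 2^-1 * 2 = 1 :> mpoly n R.
    by rewrite -mpolyC_nat -mpolyCM mulVf ?pnatr_eq0 // mpolyC1.
  rewrite qformMl qformD !cross -[RHS]mul1r -half2; ring.
pose P' a c := b * P a c + (\sum_i mpolyC n (lamE i) * sym m (lE i) a c
  + (\sum_(j | act j) mpolyC n (lam j) * sym m (lI j) a c
  + mpolyC n d * (a == c)%:R)).
have P'E v : qform P' v = b * qform P v
  + (\sum_i mpolyC n (lamE i) * ((\sum_a m a * v a) * (\sum_a lE i a * v a))
  + (\sum_(j | act j) mpolyC n (lam j) * ((\sum_a m a * v a) * (\sum_a lI j a * v a))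
  + mpolyC n d * \sum_a v a ^+ 2)).
  rewrite !qformD !qformMl qform_id !qform_sum; congr (_ + (_ + (_ + _))).
    by apply: eq_bigr => i _; rewrite qformMl sym_form.
  by apply: eq_bigr => i _; rewrite qformMl sym_form.
apply: (@ideal_qm_one_active_set R n n E I h g lE lI act
  (fun j => peval b z * lam j) P' (centered z) e0 (fun i => peval b z * lamE i)) => //.
- move=> a c; rewrite /P' Psym [c == a]eq_sym; congr (_ + (_ + (_ + _))).
    by apply: eq_bigr => i _; rewrite /sym addrC; congr (_ * (_ * _)); ring.
  by apply: eq_bigr => i _; rewrite /sym addrC; congr (_ * (_ * _)); ring.
- by move=> j Aj; rewrite mulr_gt0 ?lam0.
- rewrite P'E -/(sqdist z) !addrA; congr (_ + _); rewrite {1}GE.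
  have sE : \sum_a m a * centered z a = b - mpolyC n (peval b z).
    by apply/eqP; rewrite eq_sym subr_eq addrC -bE.
  have -> : \sum_i mpolyC n (lamE i) *
      ((\sum_a m a * centered z a) * (\sum_a lE i a * centered z a)) =
      b * (\sum_i mpolyC n (lamE i) * h i) -
      \sum_i mpolyC n (peval b z * lamE i) * h i.
    rewrite mulr_sumr -sumrB; apply: eq_bigr => i _.
    by rewrite -hE sE mpolyCM; ring.
  have -> : \sum_(j | act j) mpolyC n (lam j) *
      ((\sum_a m a * centered z a) * (\sum_a lI j a * centered z a)) =
      b * (\sum_(j | act j) mpolyC n (lam j) * g j) -
      \sum_(j | act j) mpolyC n (peval b z * lam j) * g j.
    rewrite mulr_sumr -sumrB; apply: eq_bigr => j Aj.
    by rewrite -gE // sE mpolyCM; ring.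
  by ring.
- move=> x v v1 fx0 xE xI.
  have xz : x = z.
    apply/rowP => a; apply/eqP; rewrite -subr_eq0 -peval_centered; exact/eqP.
  rewrite {}xz in xE xI *.
  suff -> : matform P' z v = peval b z * matform P z v + d.
    by rewrite addr_gt0 // mulr_gt0 // tan.
  rewrite !matform_peval P'E pevalD pevalM !pevalD pevalM pevalC; congr (_ + _).
  rewrite !peval_sum [\sum_i peval (mpolyC n (lamE i) * _) z]big1 => [|i _]; last first.
    rewrite !pevalM (_ : peval (\sum_a lE i a * _) z = 0) ?mulr0 // -[RHS](xE i).
    by rewrite peval_sum; apply: eq_bigr => a _; rewrite pevalM pevalC.
  rewrite [\sum_(j | act j) peval _ z]big1 => [|j Aj]; last first.
    rewrite !pevalM (_ : peval (\sum_a lI j a * _) z = 0) ?mulr0 // -[RHS](xI j Aj).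
    by rewrite peval_sum; apply: eq_bigr => a _; rewrite pevalM pevalC.
  rewrite !add0r -[RHS]mulr1 -v1; congr (_ * _); apply: eq_bigr => a _.
  by rewrite pevalXn pevalC.
move=> x Kx [a xa]; rewrite pevalD !pevalM pevalC ltr_pwDr //.
  rewrite mulr_gt0 // sqdist_gt0 //; apply: contraNneq xa => ->.
  by rewrite peval_centered subrr.
by rewrite mulr_ge0 ?G0 // ltW // bpos //; exact: basic_set_cube.
Qed.

(** At z = y the product is visibly a form in x - z; at any other [z] the factor [s] vanishes, and
    its cofactors turn s^2 into the square of a linear form. *)
Lemma sqdist_weight_form (s : mpoly n R) (y z : 'rV[R]_n) :
  (z != y -> peval s z = 0) ->
  exists M : 'I_n -> 'I_n -> mpoly n R, [/\ forall a b, M a b = M b a,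
    forall v, 0 <= matform M z v & s ^+ 2 * sqdist y = qform M (centered z)].
Proof.
move=> sz; have [->|/sz sz0] := eqVneq z y.
  exists (fun a b => s ^+ 2 * (a == b)%:R); split=> [a b|v|].
  - by rewrite [b == a]eq_sym.
  - have -> : matform (fun a b => s ^+ 2 * (a == b)%:R) y v =
        peval s y ^+ 2 * \sum_a v 0 a ^+ 2.
      rewrite /matform -qform_id -qformMl; apply: eq_qform => a b.
      by rewrite pevalM pevalXn; congr (_ * _); exact: rmorph_nat.
    by rewrite mulr_ge0 ?sqr_ge0 // sumr_ge0 // => a _; exact: sqr_ge0.
  - by rewrite qformMl qform_id.
have [m sE] := hadamard z s; rewrite sz0 mpolyC0 add0r in sE.
exists (fun a b => sqdist y * (m a * m b)); split=> [a b|v|].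
- by rewrite [m b * _]mulrC.
- rewrite matform_peval qformMl qform_rank1 pevalM pevalXn.
  by rewrite mulr_ge0 ?sqr_ge0 ?sqdist_ge0.
- by rewrite qformMl qform_rank1 -sE mulrC.
Qed.

Theorem ideal_qm_local_certificates G :
  (forall x, K x -> 0 <= peval G x) ->
  (forall z, K z -> peval G z = 0 -> local_certificate h g G z) ->
  ideal_qm h g G.
Proof.
move=> G0 cert; have [Z [uZ ZP]] := zeros_finite cert.
have [Z0|Z0] := eqVneq Z [::].
  apply: ideal_qm_positive => x Kx; rewrite lt0r G0 // andbT.
  by apply/eqP => Gx; have : x \in Z by [apply/ZP]; rewrite Z0.
have [|L [L1 LP]] := polynomial_partition_of_unity uZ Z0.
  by move=> z /ZP[Kz _]; exact: basic_set_cube.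
(* [G - c W] still certifies at every zero and stays nonnegative on [K] for
   small [c], and [G = sum s^2 (beta (G - c W) + c |x - z|^2)], where each
   bracket has at most one zero. *)
pose W := \sum_(t <- L) t.1.1 ^+ 2 * sqdist t.2.
have W0 x : 0 <= peval W x.
  rewrite peval_sum sumr_ge0 // => t _; rewrite pevalM pevalXn.
  by rewrite mulr_ge0 ?sqr_ge0 ?sqdist_ge0.
have Wform z : z \in Z -> exists M : 'I_n -> 'I_n -> mpoly n R,
    [/\ forall a b, M a b = M b a, forall v, 0 <= matform M z v & W = qform M (centered z)].
  move=> zZ.
  have /choice[M MP] : forall t, exists M : 'I_n -> 'I_n -> mpoly n R, t \in L ->
      [/\ forall a b, M a b = M b a, forall v, 0 <= matform M z v
         & t.1.1 ^+ 2 * sqdist t.2 = qform M (centered z)].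
    move=> t; have [tL|_] := boolP (t \in L); last by exists (fun _ _ => 0).
    have [_ _ sz] := LP t tL.
    by have [M MP] := sqdist_weight_form (sz z zZ); exists M.
  exists (fun a b => \sum_(t <- L) M t a b); split=> [a b|v|].
  - by rewrite big_seq [RHS]big_seq; apply: eq_bigr => t /MP[].
  - have -> : matform (fun a b => \sum_(t <- L) M t a b) z v = \sum_(t <- L) matform (M t) z v.
      rewrite /matform -qform_sum; apply: eq_qform => a b; exact: peval_sum.
    by rewrite big_seq sumr_ge0 // => t /MP[].
  - by rewrite qform_sum /W big_seq [RHS]big_seq; apply: eq_bigr => t /MP[].
pose G1 N := G - mpolyC n N.+1%:R^-1 * W.
have G1mono x N M : (N <= M)%N -> peval (G1 N) x <= peval (G1 M) x.
  move=> NM; rewrite !pevalB !pevalM !pevalC lerD2l lerN2 ler_wpM2r //.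
  by rewrite lef_pV2 ?posrE ?ler_nat.
have cert1 z : z \in Z -> \forall N \near \oo, local_certificate h g (G1 N) z.
  move=> zZ; have [M [Msym M0 WE]] := Wform z zZ; have /ZP[Kz Gz] := zZ.
  rewrite /G1 WE; exact: local_certificate_sub (cert z Kz Gz) Msym M0.
have WZ z : z \in Z -> peval W z = 0.
  move=> /Wform[M [_ _ ->]]; rewrite peval_qform /qform big1 // => a _.
  by rewrite big1 // => b _; rewrite peval_centered subrr mul0r mulr0.
(* Near a zero of [G] the certificate of [G1 N0] gives nonnegativity on [K]; elsewhere G > 0 absorbs
   W / (N0 + 1). As [G1] increases with its index, compactness yields one index for all of [K]. *)
have G1pos : \forall N \near \oo, forall x, K x -> 0 <= peval (G1 N) x.
  have /compact_near_coveringP/near_covering_withinP ncK := compact_basic_set.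
  apply: (ncK _ \oo (fun N x => 0 <= peval (G1 N) x) _) => x Kx.
  have [N0 hN0] : exists N0, \forall x' \near x, K x' -> 0 <= peval (G1 N0) x'.
    have [Gx0|Gx0] := eqVneq (peval G x) 0.
      have xZ : x \in Z by apply/ZP.
      have [N0 _ /(_ N0 (leqnn N0)) c1] := cert1 x xZ; exists N0.
      apply: filterS (local_certificate_isolated Kx c1) => x' hx' Kx'.
      have [->|/(hx' Kx')/ltW //] := eqVneq x' x.
      by rewrite pevalB pevalM WZ // Gx0 mulr0 subr0.
    have Gx : 0 < peval G x by rewrite lt0r Gx0 G0.
    pose N0 := Num.truncn (peval W x / peval G x); exists N0.
    have pos : 0 < peval (G1 N0) x.
      have : peval W x / peval G x < N0.+1%:R by exact: truncnS_gt.
      rewrite ltr_pdivrMr // pevalB pevalM pevalC subr_gt0 => h0.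
      by rewrite mulrC ltr_pdivrMr // mulrC.
    apply: filterS (cvgr_gt _ (@continuous_peval R n (G1 N0) x) _ pos).
    by move=> x' /ltW.
  exists ([set x' | K x' -> 0 <= peval (G1 N0) x'], [set N | (N0 <= N)%N]).
    by split=> //; exists N0.
  move=> [x' N] /= [h1 NN0] Kx'; apply: le_trans (h1 Kx') _; exact: G1mono.
have [N1 _ H1] := G1pos.
have [N2 _ H2] := near_all_seq cert1.
pose N := maxn N1 N2; pose c : R := N.+1%:R^-1.
have c0 : 0 < c by rewrite invr_gt0.
have -> : G = \sum_(t <- L) t.1.1 ^+ 2 * (t.1.2 * G1 N + mpolyC n c * sqdist t.2).
  transitivity ((\sum_(t <- L) t.1.1 ^+ 2 * t.1.2) * G1 N + mpolyC n c * W).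
    by rewrite L1 mul1r /G1 subrK.
  rewrite mulr_suml mulr_sumr -big_split; apply: eq_bigr => t _ /=; ring.
rewrite big_seq; apply: ideal_qm_sum => t tL; have [tZ bpos _] := LP t tL.
apply: ideal_qmMl; first exact: sos_sqr.
have /ZP[Kz _] := tZ.
apply: ideal_qm_single_zero => //; first by apply: H2; rewrite //= leq_maxr.
by apply: H1; rewrite /= leq_maxl.
Qed.

End LocalToGlobal.

(** * Existence of Lagrange multipliers *)

Section LagrangeMultipliers.
Variables (R : realType) (n : nat).
Implicit Types (p : mpoly n R) (u z : 'rV[R]_n).

Lemma near_peval p z (e : R) : 0 < e ->
  \forall u \near z, `|peval p u - peval p z| <= e.
Proof.
move=> e0; have /cvgrPdist_le := @continuous_peval R n p z.
by move=> /(_ e e0); apply: filterS => u; rewrite distrC.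
Qed.

(** Along u - t w, with [w] the gradient, the value drops by t (|w|^2 - O(t)). *)
Lemma local_min_grad0 p u :
  (\forall x \near u, peval p u <= peval p x) -> grad p u = 0.
Proof.
move=> umin; set w := grad p u.
have [P [pE _ _]] := taylor2 u p.
pose line (t : R) : 'rV[R]_n := u - t *: w.
have cline t0 : line t @[t --> t0] --> line t0.
  apply: cvgB; first exact: cvg_cst.
  by apply: cvgZr_tmp; exact: cvg_id.
pose s := \sum_a w 0 a ^+ 2.
have lineE t : peval p (line t) = peval p u - t * (s - t * matform P (line t) w).
  rewrite {1}pE !pevalD pevalC peval_sum peval_qform.
  have -> : qform (fun a b => peval (P a b) (line t)) (fun a => peval (centered u a) (line t)) =
      t ^+ 2 * matform P (line t) w.
    rewrite -[t ^+ 2]sqrrN -qformZr; apply: eq_bigr => a _; apply: eq_bigr => b _.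
    by rewrite !peval_centered !mxE; ring.
  have -> : \sum_a peval (mpolyC n (grad p u 0 a) * centered u a) (line t) = - t * s.
    rewrite mulr_sumr; apply: eq_bigr => a _.
    by rewrite pevalM pevalC peval_centered -/w !mxE; ring.
  by ring.
have s0 : 0 <= s by apply: sumr_ge0 => a _; exact: sqr_ge0.
have [s_gt0|] := ltP 0 s; last first.
  move=> sle0; have /psumr_eq0P wz : s = 0 by apply/eqP; rewrite eq_le sle0.
  apply/rowP => a; rewrite [RHS]mxE; apply/eqP; rewrite -sqrf_eq0 wz // => b _.
  exact: sqr_ge0.
have line0 : line 0 = u by rewrite /line scale0r subr0.
have cp (q : mpoly n R) : peval q (line t) @[t --> 0] --> peval q u.
  rewrite -line0; apply: (cvg_comp line (peval q)); first exact: cline.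
  exact: continuous_peval.
have cM : s - t * matform P (line t) w @[t --> 0] --> s - 0 * matform P u w.
  apply: cvgB; first exact: cvg_cst.
  apply: cvgM; first exact: cvg_id.
  by rewrite matform_peval; under eq_fun do rewrite matform_peval; exact: cp.
rewrite mul0r subr0 in cM.
have near1 : \forall t \near (0 : R), peval p u <= peval p (line t).
  have um : nbhs (line 0) [set x | peval p u <= peval p x] by rewrite line0.
  exact: (cline 0 _ um).
have near2 : \forall t \near (0 : R), 0 < s - t * matform P (line t) w.
  exact: (cvgr_gt _ cM _ s_gt0).
have near12 : \forall t \near (0 : R), peval p u <= peval p (line t) /\
    0 < s - t * matform P (line t) w by exact: filterI near1 near2.
have /nbhs_ballP[d /= d0 dsub] := near12.
have [] : peval p u <= peval p (line (d / 2)) /\ 0 < s - d / 2 * matform P (line (d / 2)) w.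
  apply: dsub; rewrite /ball /= sub0r normrN gtr0_norm ?divr_gt0 //; lra.
rewrite lineE => h1 h2.
have d20 : 0 < d / 2 by rewrite divr_gt0.
have h3 := mulr_gt0 d20 h2.
by move: h1; rewrite leNgt ltrBlDr ltrDl h3.
Qed.

(** [d k] represents the coordinate functional at [k] of the free family. A label is located by its
    index in [enum A], so that the dual family is indexed by labels and not by vectors. *)
Lemma free_dual_vectors (T : finType) (A : pred T) (w : T -> 'rV[R]_n) :
  free [seq w k | k in A] ->
  exists d : T -> 'rV[R]_n,
    forall j k, A j -> A k -> dotv (w j) (d k) = (j == k)%:R.
Proof.
set X := [seq w k | k in A] => freeX.
have memA k : A k -> k \in enum A by move=> Ak; rewrite mem_enum.
have idx_lt k : A k -> (index k (enum A) < size X)%N.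
  by move=> Ak; rewrite size_map index_mem memA.
exists (fun k => if insub (index k (enum A)) is Some i
  then \row_a coord (in_tuple X) (i : 'I_(size X)) (delta_mx 0 a) else 0) => j k Aj Ak.
rewrite (insubT (fun m => m < size X)%N (idx_lt k Ak)) /=.
set i := Sub _ _.
have dotE (v : 'rV[R]_n) : dotv v (\row_a coord (in_tuple X) i (delta_mx 0 a)) =
    coord (in_tuple X) i v.
  rewrite [in RHS](row_sum_delta v) linear_sum; apply: eq_bigr => a _.
  by rewrite mxE linearZ.
rewrite dotE.
have nthX m : A m -> w m = (in_tuple X)`_(index m (enum A)).
  move=> Am; rewrite /= (nth_map m) ?nth_index ?memA //.
  by rewrite index_mem memA.
rewrite (nthX j Aj) -[index j _]/(nat_of_ord (Ordinal (idx_lt j Aj))).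
rewrite coord_free // -val_eqE /=; congr ((nat_of_bool _)%:R).
apply/eqP/eqP => [h|-> //].
by have := nth_index j (memA k Ak); rewrite -h nth_index ?memA.
Qed.

Lemma le0_of_small (x C eta0 : R) : 0 < eta0 -> 0 <= C ->
  (forall eta, 0 < eta -> eta <= eta0 -> x <= eta * C) -> x <= 0.
Proof.
move=> e0 C0 H; rewrite leNgt; apply/negP => x0.
have C1 : 0 < 2 * (C + 1) by lra.
have eta_gt0 : 0 < Num.min eta0 (x / (2 * (C + 1))).
  by rewrite lt_min e0 divr_gt0.
have := H _ eta_gt0; rewrite ge_min lexx => /(_ isT).
have : Num.min eta0 (x / (2 * (C + 1))) * C <= x / (2 * (C + 1)) * C.
  by rewrite ler_wpM2r // ge_min lexx orbT.
have : x / (2 * (C + 1)) * C <= x / 2.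
  by rewrite mulrAC ler_pdivrMr // ; nra.
lra.
Qed.

Section Penalty.
Variables (E I : finType) (P : pop R n E I) (z : 'rV[R]_n).
Hypothesis zmin : minimizer P z.

Let box : set 'rV[R]_n := [set u | forall i, `|u 0 i - z 0 i| <= 1].

Let compact_box : compact box.
Proof.
rewrite (_ : box = [set v : 'rV[R]_n | forall i, `[z 0 i - 1, z 0 i + 1]%classic (v ord0 i)]).
  by apply: (@rV_compact _ n (fun i => `[z 0 i - 1, z 0 i + 1]%classic)) => i;
    exact: segment_compact.
apply/seteqP; split => x /= H i; have := H i; rewrite in_itv /= ler_norml.
  by move=> /andP[? ?]; apply/andP; split; lra.
by move=> /andP[? ?]; apply/andP; split; lra.
Qed.

(** A quadratic penalty function normalized to vanish at [z]. The term [sqdist z] makes [z] a strict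
    minimizer, so that at every other point the value is positive for large [N]. *)
Definition penalty (N : nat) (u : 'rV[R]_n) : R :=
  peval (obj P) u - peval (obj P) z + peval (sqdist z) u
  + N%:R * (\sum_i peval (eqc P i) u ^+ 2
            + \sum_j Num.min 0 (peval (ineqc P j) u) ^+ 2).

Let continuous_penalty N : continuous (penalty N).
Proof.
have sq (f : 'rV[R]_n -> R) : continuous f -> continuous (fun u => f u ^+ 2).
  by move=> cf u; exact: continuousM (cf u) (cf u).
have c1 : continuous (fun u => \sum_i peval (eqc P i) u ^+ 2).
  by apply: continuous_sumr => i; apply: sq; exact: continuous_peval.
have c2 : continuous (fun u => \sum_j Num.min 0 (peval (ineqc P j) u) ^+ 2).
  apply: continuous_sumr => j; apply: sq => u.
  exact: continuous_min (@cst_continuous _ _ (0 : R) u) (@continuous_peval R n (ineqc P j) u).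
have c3 : continuous (fun u => peval (obj P) u - peval (obj P) z + peval (sqdist z) u).
  rewrite (_ : (fun u => _) = peval (obj P - mpolyC n (peval (obj P) z) + sqdist z)).
    exact: continuous_peval.
  by apply/funext => u; rewrite pevalD pevalB pevalC.
move=> u; exact: continuousD (c3 u)
  (continuousM (@cst_continuous _ _ (N%:R : R) u) (continuousD (c1 u) (c2 u))).
Qed.

Let infeas0 u : 0 <= \sum_i peval (eqc P i) u ^+ 2
            + \sum_j Num.min 0 (peval (ineqc P j) u) ^+ 2.
Proof. by rewrite addr_ge0 // sumr_ge0 // => i _; exact: sqr_ge0. Qed.

Let penalty_pos u : u != z -> exists N, 0 < penalty N u.
Proof.
move=> uz; have D0 := sqdist_gt0 uz; rewrite /penalty.
set X := _ + \sum_j _; have [X0|] := ltP 0 X.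
  set y := _ + peval (sqdist z) u; exists (Num.truncn (`|y| / X)).+1.
  have : `|y| / X < (Num.truncn (`|y| / X)).+1%:R by exact: truncnS_gt.
  rewrite ltr_pdivrMr //; have := ler_norm (- y); rewrite normrN.
  by move: (_ * X) => ?; lra.
move=> Xle0; have {Xle0} : X == 0 by rewrite eq_le Xle0 infeas0.
rewrite paddr_eq0 ?sumr_ge0 //; try by move=> ? _; exact: sqr_ge0.
move=> /andP[/eqP/psumr_eq0P hE /eqP/psumr_eq0P hI].
exists 0%N; rewrite mul0r addr0 ltr_wpDl // subr_ge0; apply: (zmin.2).
split=> i.
  by apply/eqP; rewrite -sqrf_eq0 hE // => k _; exact: sqr_ge0.
have : Num.min 0 (peval (ineqc P i) u) == 0.
  by rewrite -sqrf_eq0 hI // => k _; exact: sqr_ge0.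
by rewrite eq_minl.
Qed.

Let penalty_z N : penalty N z = 0.
Proof.
have [hz gz] := zmin.1; rewrite /penalty subrr add0r.
rewrite [\sum_i peval (eqc P i) z ^+ 2]big1 => [|i _]; last by rewrite hz expr0n.
rewrite big1 => [|j _]; last by rewrite min_l // expr0n.
rewrite addr0 mulr0 addr0 peval_sqdist big1 // => a _.
by rewrite subrr expr0n.
Qed.

(** For large [N] the penalty function is positive on the box outside a given neighborhood of [z],
    and it is zero at [z]; so its minimum over the box is attained close to [z], and stationarity
    there is the multiplier equation. *)
Lemma approximate_multipliers (Q : set 'rV[R]_n) : (\forall u \near z, Q u) ->
  exists (u : 'rV[R]_n) (mu : E + I -> R), [/\ Q u, forall j, 0 <= mu (inr j),
    forall k, ~~ active P z k -> mu k = 0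
    & forall a, grad (obj P) u 0 a + 2 * (u 0 a - z 0 a) =
                \sum_k mu k * grad (constr P k) u 0 a].
Proof.
move=> nQ.
(* Interior to the box, the minimizer is an unconstrained local one. Inequalities inactive at [z]
   stay positive, so their multipliers are exactly zero. *)
pose Q' u := [/\ Q u, forall i, `|u 0 i - z 0 i| < 1
  & forall j, 0 < peval (ineqc P j) z -> 0 < peval (ineqc P j) u].
have nQ' : \forall u \near z, Q' u.
  have n1 : \forall u \near z, forall i, `|(u : 'rV[R]_n) 0 i - z 0 i| < 1.
    apply: (@filter_forall _ _ _ (nbhs z) _) => i.
    have /cvgrPdist_lt/(_ 1 ltr01) := @continuous_coord R n i z.
    by apply: filterS => u; rewrite distrC.
  have n2 : \forall u \near z, forall j, 0 < peval (ineqc P j) z -> 0 < peval (ineqc P j) u.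
    apply: (@filter_forall _ _ _ (nbhs z) _) => j.
    have [gj|_] := ltP 0 (peval (ineqc P j) z); last exact: nearW.
    by apply: filterS (cvgr_gt _ (@continuous_peval R n (ineqc P j) z) _ gj).
  by apply: filterS3 nQ n1 n2 => u ? ? ?; split.
have [U [oU Uz] UQ] : exists2 U : set 'rV[R]_n, open_nbhs z U & U `<=` Q'.
  have : nbhs z Q' by exact: nQ'.
  by rewrite nbhsE => -[U nU UQ]; exists U.
have [N HN] : exists N, forall u, (box `&` ~` U) u -> 0 < penalty N u.
  apply: (dini_positive _ continuous_penalty).
  - by apply: compact_closedI => //; exact: open_closedC.
  - by move=> u N M _ NM; rewrite /penalty lerD2l ler_wpM2r ?infeas0 // ler_nat.
  - move=> u [_ nUu]; apply: penalty_pos; apply/eqP => uz.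
    by apply: nUu; rewrite uz.
have box_z : box z by move=> i; rewrite subrr normr0.
have [u ubox umin] : exists2 u, u \in box & forall v, v \in box -> penalty N u <= penalty N v.
  apply: compact_EVT_min => //; first by exists z.
  by apply: continuous_subspaceT; exact: continuous_penalty.
rewrite inE in ubox.
have Uu : U u.
  apply: contrapT => nUu; have := HN u (conj ubox nUu).
  by rewrite ltNge -(penalty_z N) umin // inE.
have [Qu u1 gu] := UQ u Uu.
(* Replacing [min(0, g_j)^2] by [(g_j - max(0, g_j(u)))^2] turns the penalty
   function into a polynomial which majorizes it and agrees with it at [u]. *)
pose c j := Num.max 0 (peval (ineqc P j) u).
pose Psi : mpoly n R := obj P + sqdist z + mpolyC n N%:R *
  (\sum_i eqc P i ^+ 2 + \sum_j (ineqc P j - mpolyC n (c j)) ^+ 2).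
have PsiE x : peval Psi x = peval (obj P) x + peval (sqdist z) x + N%:R *
  (\sum_i peval (eqc P i) x ^+ 2 + \sum_j (peval (ineqc P j) x - c j) ^+ 2).
  rewrite !pevalD pevalM pevalC pevalD !peval_sum; congr (_ + _ * (_ + _)).
    by apply: eq_bigr => i _; rewrite pevalXn.
  by apply: eq_bigr => i _; rewrite pevalXn pevalB pevalC.
have zE x : penalty N x + peval (obj P) z = peval (obj P) x + peval (sqdist z) x
    + N%:R * (\sum_i peval (eqc P i) x ^+ 2 + \sum_j Num.min 0 (peval (ineqc P j) x) ^+ 2).
  by rewrite /penalty; ring.
have Psi_ge x : penalty N x + peval (obj P) z <= peval Psi x.
  rewrite zE PsiE lerD2l ler_wpM2l // lerD2l; apply: ler_sum => j _.
  have : 0 <= c j by rewrite /c le_max lexx.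
  move: (c j) (peval _ x) => t y t0.
  by rewrite minEle; case: (leP 0 y) => y0; [rewrite expr0n sqr_ge0 | nra].
have cE j : peval (ineqc P j) u - c j = Num.min 0 (peval (ineqc P j) u).
  by rewrite /c; case: (leP 0 (peval (ineqc P j) u)) => _; rewrite ?subrr ?subr0.
have Psi_u : penalty N u + peval (obj P) z = peval Psi u.
  rewrite zE PsiE; congr (_ + _ * (_ + _)).
  by apply: eq_bigr => j _; rewrite cE.
have grad0 : grad Psi u = 0.
  apply: local_min_grad0; rewrite -Psi_u.
  have nbox : \forall x \near u, forall i, `|(x : 'rV[R]_n) 0 i - z 0 i| <= 1.
    apply: (@filter_forall _ _ _ (nbhs u) _) => i.
    have ui : 0 < 1 - `|u 0 i - z 0 i| by rewrite subr_gt0.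
    have /cvgrPdist_lt/(_ _ ui) := @continuous_coord R n i u.
    apply: filterS => x h; have -> : x 0 i - z 0 i = - (u 0 i - x 0 i) + (u 0 i - z 0 i) by ring.
    by apply: le_trans (ler_normD _ _) _; rewrite normrN; move: h; lra.
  apply: filterS nbox => x xbox; apply: le_trans (Psi_ge x).
  by rewrite lerD2r umin // inE.
(* Derivatives of the penalty terms moved to the other side; those of the inequalities are
   nonnegative since min(0, g_j) <= 0. *)
exists u, (fun k => match k with
  | inl i => - (N%:R * (2 * peval (eqc P i) u))
  | inr j => - (N%:R * (2 * Num.min 0 (peval (ineqc P j) u))) end).
split=> // [j|[i|j]|a].
- by rewrite oppr_ge0 mulr_ge0_le0 // mulr_ge0_le0 // ge_min lexx.
- by rewrite /active /= zmin.1.1 eqxx.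
- rewrite /active /= => gz; rewrite min_l ?mulr0 ?oppr0 // ltW // gu //.
  by rewrite lt0r gz zmin.1.2.
have dsq p : mderiv a (p ^+ 2) = mpolyC n 2 * (p * mderiv a p).
  by rewrite expr2 mderivM mpolyC_nat; ring.
have /rowP/(_ a) := grad0; rewrite !mxE !mderivD mderivM mderivC mul0r add0r.
rewrite mderivD !raddf_sum /= big_sumType /=.
have d2 : \sum_i mderiv a (centered z i ^+ 2) = mpolyC n 2 * centered z a.
  rewrite (bigD1 a) //= dsq mderiv_centered eqxx mulr1 big1 ?addr0 // => i /negbTE ia.
  by rewrite dsq mderiv_centered ia !mulr0.
have dz : peval (\sum_i mderiv a (centered z i ^+ 2)) u = 2 * (u 0 a - z 0 a).
  by rewrite d2 pevalM pevalC peval_centered.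
rewrite 2!pevalD dz pevalM pevalC pevalD !peval_sum.
move=> /eqP; rewrite addr_eq0 => /eqP ->.
rewrite mulrDr opprD !mulr_sumr -!sumrN; congr (_ + _); apply: eq_bigr => i _.
  by rewrite dsq !pevalM pevalC mxE; ring.
by rewrite dsq mderivB mderivC subr0 !pevalM pevalB !pevalC cE mxE; ring.
Qed.

(** No convergent subsequence is extracted: pairing the gradient of the objective with the dual
    vectors defines [lam] outright, and approximate multipliers close to [z] must agree with it up
    to O(eta). The multiplier conditions then hold up to arbitrarily small errors. *)
Lemma kkt_multiplier : LICQC P z -> exists lam, lagrange_multiplier P z lam.
Proof.
move=> /free_dual_vectors[d dual].
set A := active P z in dual *.
pose X a : mpoly n R := mderiv a (obj P) + mpolyC n 2 * centered z a.
pose pA k : mpoly n R := \sum_a X a * mpolyC n (d k 0 a).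
pose pw c k : mpoly n R := \sum_a mderiv a (constr P c) * mpolyC n (d k 0 a).
pose lam k := if A k then peval (pA k) z else 0.
have XE a u : peval (X a) u = grad (obj P) u 0 a + 2 * (u 0 a - z 0 a).
  by rewrite pevalD pevalM pevalC peval_centered mxE.
have pwE c k u : peval (pw c k) u = dotv (grad (constr P c) u) (d k).
  by rewrite peval_sum; apply: eq_bigr => a _; rewrite pevalM pevalC mxE.
(* S <= sum |lam| + (1 + S) / 2 will give S <= S0; [eta0] is small enough to produce the factor
   1/2. *)
pose S0 := 2 * (\sum_k `|lam k|) + 1; pose B := 1 + S0.
have S00 : 0 <= S0 by rewrite addr_ge0 // mulr_ge0 // sumr_ge0.
have B0 : 0 <= B by rewrite addr_ge0.
pose eta0 : R := (2 * #|{: E + I}|.+1%:R)^-1.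
have eta00 : 0 < eta0 by rewrite invr_gt0 mulr_gt0.
have approx eta : 0 < eta -> eta <= eta0 ->
    (forall j, - lam (inr j) <= eta * B) /\
    forall a, `|grad (obj P) z 0 a - \sum_k lam k * grad (constr P k) z 0 a| <=
      eta * (B + B * \sum_k `|grad (constr P k) z 0 a|).
  move=> eta_gt0 eta_le.
  have nQ : \forall u \near z, [/\ forall k, `|peval (pA k) u - peval (pA k) z| <= eta,
      forall ck : (E + I) * (E + I), `|peval (pw ck.1 ck.2) u - peval (pw ck.1 ck.2) z| <= eta,
      forall ca : (E + I) * 'I_n, `|peval (mderiv ca.2 (constr P ca.1)) u -
                                    peval (mderiv ca.2 (constr P ca.1)) z| <= eta
      & forall a, `|peval (X a) u - peval (X a) z| <= eta].
    have n1 : \forall u \near z, forall k, `|peval (pA k) u - peval (pA k) z| <= eta.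
      by apply: (@filter_forall _ _ _ (nbhs z) _) => k; exact: near_peval.
    have n2 : \forall u \near z, forall ck : (E + I) * (E + I),
        `|peval (pw ck.1 ck.2) u - peval (pw ck.1 ck.2) z| <= eta.
      by apply: (@filter_forall _ _ _ (nbhs z) _) => k; exact: near_peval.
    have n3 : \forall u \near z, forall ca : (E + I) * 'I_n,
        `|peval (mderiv ca.2 (constr P ca.1)) u - peval (mderiv ca.2 (constr P ca.1)) z| <= eta.
      by apply: (@filter_forall _ _ _ (nbhs z) _) => k; exact: near_peval.
    have n4 : \forall u \near z, forall a, `|peval (X a) u - peval (X a) z| <= eta.
      by apply: (@filter_forall _ _ _ (nbhs z) _) => k; exact: near_peval.
    by near=> u; split; near: u.
  have [u [mu [[q1 q2 q3 q4] mu0 muA muE]]] := approximate_multipliers nQ.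
  pose S := \sum_k `|mu k|.
  have rel k : A k -> `|peval (pA k) u - mu k| <= eta * S.
    move=> Ak.
    have -> : peval (pA k) u = \sum_c mu c * peval (pw c k) u.
      rewrite peval_sum.
      transitivity (\sum_a \sum_c mu c * (grad (constr P c) u 0 a * d k 0 a)).
        apply: eq_bigr => a _; rewrite pevalM pevalC XE muE mulr_suml.
        by apply: eq_bigr => c _; rewrite mulrA.
      rewrite exchange_big; apply: eq_bigr => c _; rewrite peval_sum mulr_sumr.
      by apply: eq_bigr => a _; rewrite pevalM pevalC mxE.
    have -> : mu k = \sum_c mu c * peval (pw c k) z.
      rewrite (bigD1 k) //= [X in _ + X]big1 => [|c ck].
        by rewrite pwE dual // eqxx mulr1 addr0.
      have [Ac|nAc] := boolP (A c); last by rewrite muA // mul0r.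
      by rewrite pwE dual // (negbTE ck) mulr0.
    rewrite -sumrB mulr_sumr; apply: le_trans (ler_norm_sum _ _ _) _.
    apply: ler_sum => c _; rewrite -mulrBr normrM mulrC ler_wpM2r //.
    exact: (q2 (c, k)).
  have mulam k : `|mu k - lam k| <= eta * (1 + S).
    rewrite /lam; case: ifP => [Ak|/negbT nAk]; last first.
      rewrite muA // subr0 normr0 mulr_ge0 ?(ltW eta_gt0) // addr_ge0 //.
      by rewrite sumr_ge0.
    have := rel k Ak; have := q1 k; rewrite distrC => h1 h2.
    have -> : mu k - peval (pA k) z = (peval (pA k) u - peval (pA k) z) - (peval (pA k) u - mu k) by ring.
    apply: le_trans (ler_normB _ _) _; rewrite mulrDr mulr1.
    by rewrite distrC in h1; exact: lerD.
  have SS0 : S <= S0.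
    have : S <= \sum_k `|lam k| + #|{: E + I}|%:R * (eta * (1 + S)).
      rewrite mulr_natl -sumr_const -big_split; apply: ler_sum => k _ /=.
      have -> : mu k = lam k + (mu k - lam k) by ring.
      by apply: le_trans (ler_normD _ _) _; rewrite lerD2l; apply: mulam.
    have S1 : 0 <= 1 + S by rewrite addr_ge0 // sumr_ge0.
    have : #|{: E + I}|%:R * (eta * (1 + S)) <= 2^-1 * (1 + S).
      rewrite mulrA ler_wpM2r //.
      apply: le_trans (_ : #|{: E + I}|%:R * eta0 <= _); first by rewrite ler_wpM2l.
      rewrite /eta0 invfM mulrCA ler_piMr // ler_pdivrMr // mul1r ler_nat.
      exact: leqnSn.
    rewrite /S0; move: (#|_|%:R * _) => y; lra.
  have {}mulam k : `|mu k - lam k| <= eta * B.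
    by apply: le_trans (mulam k) _; rewrite ler_wpM2l ?(ltW eta_gt0) // lerD2l.
  split=> [j|a].
    have := mulam (inr j); rewrite ler_norml => /andP[_ h].
    by have := mu0 j; move: h; move: (eta * B) => y; lra.
  have -> : grad (obj P) z 0 a = peval (X a) z by rewrite XE subrr mulr0 addr0.
  have -> : peval (X a) z - \sum_k lam k * grad (constr P k) z 0 a =
      - (peval (X a) u - peval (X a) z) +
      \sum_k (mu k * (grad (constr P k) u 0 a - grad (constr P k) z 0 a)
              + (mu k - lam k) * grad (constr P k) z 0 a).
    rewrite [peval (X a) u]XE muE opprB -addrA; congr (_ + _).
    rewrite addrC -sumrB -sumrN; apply: eq_bigr => k _; ring.
  apply: le_trans (ler_normD _ _) _; rewrite normrN.
  have -> : eta * (B + B * \sum_k `|grad (constr P k) z 0 a|) =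
     eta + (eta * S0 + eta * B * \sum_k `|grad (constr P k) z 0 a|) by rewrite /B; ring.
  apply: lerD; first exact: q4.
  apply: le_trans (ler_norm_sum _ _ _) _.
  apply: le_trans (_ : \sum_k (eta * `|mu k| + eta * B * `|grad (constr P k) z 0 a|) <= _).
    apply: ler_sum => k _; apply: le_trans (ler_normD _ _) _; rewrite !normrM.
    apply: lerD; last by rewrite ler_wpM2r.
    by rewrite mulrC ler_wpM2r //; have := q3 (k, a); rewrite !mxE.
  by rewrite big_split /= -!mulr_sumr lerD2r ler_wpM2l // ltW.
exists lam; split.
  apply/rowP => a; rewrite summxE; under [RHS]eq_bigr do rewrite mxE.
  apply/eqP; rewrite -subr_eq0 -normr_le0.
  apply: (le0_of_small eta00 (C := B + B * \sum_k `|grad (constr P k) z 0 a|)).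
    by rewrite addr_ge0 // mulr_ge0 // sumr_ge0.
  by move=> eta h1 h2; have [_] := approx eta h1 h2; apply.
move=> j; split.
  rewrite -oppr_le0; apply: (le0_of_small eta00 B0) => eta h1 h2.
  by have [+ _] := approx eta h1 h2; apply.
rewrite /lam; case: ifP => [|_]; last by rewrite mul0r.
by rewrite /A /active /= => /eqP ->; rewrite mulr0.
Unshelve. all: by end_near. Qed.

End Penalty.
End LagrangeMultipliers.

(** * Minimizers at infinity *)

Section MinimizersAtInfinity.
Variables (R : realType) (n : nat) (E I : finType).

Lemma hpointK (u : 'rV[R]_n.+1) :
  hpoint (u 0 ord0) (\row_j u 0 (lift ord0 j)) = u.
Proof.
apply/rowP => a; rewrite mxE; case: unliftP => [j|] -> //.
by rewrite mxE.
Qed.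

(** For x_0 > 0 the value is x_0^d (f(x / x_0) - fmin) with x / x_0 feasible for (P). Closedness at
    infinity makes such points dense in the cone, and continuity gives the rest. *)
Lemma homogenized_obj_ge0 (P : pop R n E I) (fmin : R) u :
  optimal_value P = fmin%:E -> closed_at_infty P ->
  feasible (homogenized P fmin) u -> 0 <= peval (obj (homogenized P fmin)) u.
Proof.
move=> hfmin hclosed [hu gu].
have : homog_cone P u.
  split=> [i|j|]; [exact: hu (Some i) | exact: gu (Some j) |].
  by have := gu None; rewrite /= pevalX.
rewrite -hclosed; set C := _ `&` _; move: u {hu gu}.
set F := obj _; suff : C `<=` [set u | - peval F u <= 0].
  move=> CF u Cu; rewrite -oppr_le0.
  have /closure_id : closed [set u | - peval F u <= 0].
    apply: closed_le_continuous => v; apply: continuousN; exact: continuous_peval.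
  by rewrite /= => FE; have := closureS CF Cu; rewrite -FE.
move=> u [[hu gu _] /= u0]; rewrite oppr_le0.
pose v := (u 0 ord0)^-1 *: \row_j u 0 (lift ord0 j).
have homE p : peval (homogenize p) u = u 0 ord0 ^+ pdeg p * peval p v.
  by rewrite -{1}(hpointK u) homogenizeE // gt_eqF.
have feas : feasible P v.
  split=> i; [have := hu i | have := gu i]; rewrite homE.
    by move=> /eqP; rewrite mulf_eq0 gt_eqF ?exprn_gt0 //= => /eqP.
  by rewrite pmulr_rge0 // exprn_gt0.
rewrite /F /= pevalB pevalZ pevalXn pevalX homE mulrC -mulrBl.
rewrite mulr_ge0 ?subr_ge0 ?exprn_ge0 ?(ltW u0) //.
by rewrite -lee_fin -hfmin; apply: ereal_inf_lbound; exists v.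
Qed.

(** For d = 1 the term is linear and goes to the multiplier of the active constraint x_0 >= 0. For d
    >= 2 it is c x_0^(d - 2) times the square of x_0 - z_0, hence a form in x - z that is positive
    semidefinite at [z]. *)
Lemma pvar_pow_certificate (z : 'rV[R]_n.+1) (c : R) (d : nat) :
  0 < c -> z 0 ord0 = 0 -> (0 < d)%N ->
  exists (t : R) (Q : 'I_n.+1 -> 'I_n.+1 -> mpoly n.+1 R),
  [/\ 0 <= t, forall a b, Q a b = Q b a, forall v, 0 <= matform Q z v &
      c *: pvar R ord0 ^+ d = mpolyC n.+1 t * pvar R ord0 + qform Q (centered z)].
Proof.
move=> c0 z0; case: d => [//|[|d]] _.
  exists c, (fun _ _ => 0); split=> // [|v|]; first exact: ltW.
    by rewrite /matform /qform sumr_ge0 // => a _; rewrite sumr_ge0 // => b _;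
      rewrite peval0 mul0r.
  rewrite mul_mpolyC expr1 /qform big1 ?addr0 // => a _.
  by rewrite big1 // => b _; rewrite mul0r.
have zc : centered z ord0 = pvar R ord0 by rewrite /centered z0 mpolyC0 subr0.
have dE (v : 'I_n.+1 -> mpoly n.+1 R) : \sum_a (a == ord0)%:R * v a = v ord0.
  rewrite (bigD1 ord0) // big1 => [|a /negbTE ->]; last by rewrite mul0r.
  by rewrite /= addr0 mul1r.
exists 0, (fun a b => (c *: pvar R ord0 ^+ d) * ((a == ord0)%:R * (b == ord0)%:R)).
split=> // [a b|v|]; first by rewrite [(b == _)%:R * _]mulrC.
  rewrite matform_peval qformMl qform_rank1 dE pevalM pevalXn pevalZ pevalXn pevalX z0 pevalC.
  by rewrite mulr_ge0 ?sqr_ge0 // mulr_ge0 ?(ltW c0) // exprn_ge0.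
rewrite mpolyC0 mul0r add0r qformMl qform_rank1 dE zc -scalerAl -exprD.
by rewrite addn2.
Qed.

(** The Lagrangian and its gradient vanish at [z], so its Taylor expansion is exactly a form in x -
    z, with half the Hessian as matrix at [z]. SCC makes the active multipliers positive and SOSC
    makes the form positive on tangent directions. *)
Lemma optimality_certificate (H : pop R n E I) (z : 'rV[R]_n) :
  minimizer H z -> peval (obj H) z = 0 -> optimality_conditions H z ->
  local_certificate (eqc H) (ineqc H) (obj H) z.
Proof.
move=> zmin Hz0 [licq scc sosc]; have [[hz gz] _] := zmin.
have [lam lagr] := kkt_multiplier zmin licq; have [gradE compl] := lagr.
pose Lg := lagrangian H lam.
have [PL [LgE PLsym PLhess]] := taylor2 z Lg.
have lamI0 j : peval (ineqc H j) z != 0 -> lam (inr j) = 0.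
  by move=> gj; have [_ /eqP] := compl j; rewrite mulf_eq0 (negbTE gj) orbF => /eqP.
have Lgz : peval Lg z = 0.
  rewrite /Lg /lagrangian pevalB Hz0 sub0r peval_sum big_sumType /=.
  rewrite big1 => [|i _]; last by rewrite pevalZ hz mulr0.
  rewrite big1 => [|j _]; last by have [_] := compl j; rewrite pevalZ.
  by rewrite addr0 oppr0.
have Lggrad a : grad Lg z 0 a = 0.
  have dS : mderiv a (\sum_k lam k *: constr H k) = \sum_k lam k *: mderiv a (constr H k).
    by rewrite raddf_sum; apply: eq_bigr => k _; exact: mderivZ.
  rewrite mxE /Lg /lagrangian mderivB pevalB dS.
  have /rowP/(_ a) := gradE; rewrite mxE => ->.
  rewrite summxE peval_sum -sumrB big1 // => k _.
  by rewrite pevalZ !mxE subrr.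
have LgP : Lg = qform PL (centered z).
  rewrite LgE Lgz mpolyC0 add0r big1 ?add0r // => a _.
  by rewrite Lggrad mpolyC0 mul0r.
have /choice[lE hE] : forall i, exists l : 'I_n -> mpoly n R,
    eqc H i = \sum_a l a * centered z a.
  move=> i; have [l] := hadamard z (eqc H i).
  by rewrite hz mpolyC0 add0r => lE; exists l.
have /choice[lI gE] : forall j, exists l : 'I_n -> mpoly n R,
    peval (ineqc H j) z == 0 -> ineqc H j = \sum_a l a * centered z a.
  move=> j; have [l lE'] := hadamard z (ineqc H j).
  by exists l => /eqP gj; rewrite {1}lE' gj mpolyC0 add0r.
exists PL, lE, lI, (fun i => lam (inl i)), (fun j => lam (inr j)); split=> //.
  split=> [j Aj|].
    by have := scc lam lagr j; rewrite (eqP Aj) addr0.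
  rewrite -LgP /Lg /lagrangian big_sumType /=.
  have -> : \sum_j lam (inr j) *: ineqc H j =
      \sum_(j | peval (ineqc H j) z == 0) mpolyC n (lam (inr j)) * ineqc H j.
    rewrite (bigID (fun j => peval (ineqc H j) z == 0)) /= [X in _ + X]big1 ?addr0.
      by apply: eq_bigr => j _; rewrite mul_mpolyC.
    by move=> j gj; rewrite lamI0 // scale0r.
  have -> : \sum_i lam (inl i) *: eqc H i = \sum_i mpolyC n (lam (inl i)) * eqc H i.
    by apply: eq_bigr => i _; rewrite mul_mpolyC.
  by rewrite /=; ring.
move=> v v1 vE vI.
have vN0 : v != 0.
  apply: contra_eqN v1 => /eqP ->; rewrite big1 => [|a _]; first by rewrite eq_sym oner_eq0.
  by rewrite mxE expr0n.
have := sosc lam lagr v vN0.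
have gradl k (l : 'I_n -> mpoly n R) :
    constr H k = \sum_a l a * centered z a ->
    dotv (grad (constr H k) z) v = \sum_a peval (l a) z * v 0 a.
  move=> kE; apply: eq_bigr => a _; congr (_ * _).
  by rewrite (@grad_hadamard _ _ z (constr H k) 0 l) // mpolyC0 add0r.
have -> : (v *m hessian (lagrangian H lam) z *m v^T) 0 0 = 2 * matform PL z v.
  rewrite mxE mulr_sumr; apply: eq_bigr => a _; rewrite !mxE mulr_suml mulr_sumr.
  by apply: eq_bigr => b _; rewrite -PLhess [PL b a]PLsym; ring.
rewrite pmulr_rgt0 //; apply=> -[i|j] kA.
  by rewrite (gradl (inl i) _ (hE i)) vE.
by rewrite (gradl (inr j) _ (gE j kA)) vI.
Qed.

End MinimizersAtInfinity.

(** * Certificates for the perturbed homogenized objective *)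

Theorem theorem8p1 (R : realType) (n : nat) (E I : finType) (P : pop R n E I)
    (fmin : R) (hfmin : optimal_value P = fmin%:E)
    (hclosed : closed_at_infty P)
    (hmin : forall u : 'rV[R]_n, minimizer P u -> optimality_conditions P u)
    (hmin_infty : forall x : 'rV[R]_n, minimizer_at_infty P fmin x ->
       optimality_conditions (homogenized P fmin) (hpoint 0 x)) :
  exists k0 : nat, (0 < k0)%N /\
    forall eps : R, 0 < eps -> forall l : nat, (k0 <= l)%N ->
      [set p + q | p in ideal_gen (eqc (homogenized P fmin))
                 & q in quadratic_module (ineqc (homogenized P fmin))]
        (pvar R ord0 ^+ (2 * l) *
           (homogenize (obj P) - (fmin - eps) *: pvar R ord0 ^+ pdeg (obj P))).
Proof.
exists 1%N; split=> // eps eps0 l _.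
set H := homogenized P fmin; set d := pdeg (obj P); set G := _ - _ *: _.
suff GM : ideal_qm (eqc H) (ineqc H) G.
  rewrite mulnC exprM; exact: ideal_qmMl (sos_sqr _) GM.
have GE : G = obj H + eps *: pvar R ord0 ^+ d.
  by rewrite /G /= scalerBl opprB addrA addrAC.
have F0 u : feasible H u -> 0 <= peval (obj H) u by exact: homogenized_obj_ge0.
have x0 u : feasible H u -> 0 <= u 0 ord0.
  by move=> [_ /(_ None)]; rewrite /= pevalX.
have epsx u : peval (eps *: pvar R ord0 ^+ d) u = eps * u 0 ord0 ^+ d.
  by rewrite pevalZ pevalXn pevalX.
apply: (@ideal_qm_local_certificates _ _ _ _ _ _ None) => //.
  move=> u Ku; rewrite GE pevalD epsx addr_ge0 ?F0 //.
  by rewrite mulr_ge0 ?(ltW eps0) // exprn_ge0 // x0.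
move=> z Kz /eqP; rewrite GE pevalD epsx.
have z00 := x0 z Kz; have Fz0 := F0 z Kz.
(* Both summands are nonnegative, so both vanish. The equation z_0^d = 0 yields z_0 = 0 and also 0 <
   d, since a power with exponent 0 is 1. *)
rewrite paddr_eq0 ?mulr_ge0 ?(ltW eps0) ?exprn_ge0 // mulf_eq0 (gt_eqF eps0) orFb.
rewrite expf_eq0 => /andP[/eqP Fz /andP[d0 /eqP z0]].
have zE : hpoint 0 (\row_j z 0 (lift ord0 j)) = z by rewrite -[RHS]hpointK z0.
have oc : optimality_conditions H z.
  by rewrite -zE; apply: hmin_infty; rewrite /minimizer_at_infty zE.
have zmin : minimizer H z by split=> // v /F0; rewrite Fz.
have [Q [lE [lI [lamE [lam [Qsym hE gE [lam0 FE] tan]]]]]] := optimality_certificate zmin Fz oc.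
have [t [Qe [t0 Qesym Qe0 QeE]]] := pvar_pow_certificate eps0 z0 d0.
(* The linear part t x_0 of the perturbation is added to the multiplier of x_0 >= 0, labelled
   [None], which is active at [z]. *)
exists (fun a b => Q a b + Qe a b), lE, lI, lamE,
  (fun j => lam j + (if j is None then t else 0)); split=> //.
- by move=> a b; rewrite Qsym Qesym.
- split=> [j Aj|]; first by apply: ltr_wpDr; [case: j {Aj} | exact: lam0].
  rewrite QeE {1}FE qformD.
  have Anone : peval (ineqc H None) z == 0 by rewrite /= pevalX z0.
  have -> : \sum_(j | peval (ineqc H j) z == 0)
        mpolyC n.+1 (lam j + (if j is None then t else 0)) * ineqc H j =
      \sum_(j | peval (ineqc H j) z == 0) mpolyC n.+1 (lam j) * ineqc H j
      + mpolyC n.+1 t * pvar R ord0.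
    rewrite (bigD1 None) //= [X in _ = X + _](bigD1 None) //= mpolyCD mulrDl.
    rewrite -!addrA; congr (_ + _); rewrite addrC; congr (_ + _).
    by apply: eq_bigr => -[j|]; rewrite ?andbF // => _; rewrite addr0.
  by ring.
move=> v v1 vE vI; rewrite /matform.
rewrite (@eq_qform _ _ _ (fun a b => peval (Q a b) z + peval (Qe a b) z)).
  by rewrite qformD ltr_pwDl //; [exact: tan | exact: Qe0].
by move=> a b; rewrite pevalD.
Qed.
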